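(* Let $s_0 > s_1 > \dots > s_k$ be any finite set of decreasingly ordered real numbers. Then there exists a function $F$ (on the positive reals, depending only on the set $\{s_i\}_{i=0}^k$) such that for all $\Delta \in \mathcal{D}(\{s_i\}_{i=0}^k)$ and any $m > s_0 - s_k$, setting $\epsilon(\Lambda) = m \log \Lambda / \Lambda$, $$\operatorname{res}_{s=s_k} \big(\zeta(\Delta,s)\,\Gamma(s)\big) = \lim_{\Lambda \to \infty} \epsilon(\Lambda)^{s_k} \operatorname{tr}_\Lambda F(\Delta\, \epsilon(\Lambda)).$$
   Context: A positive, invertible, self-adjoint, unbounded operator $\Delta$ with compact resolvent on a Hilbert space is called spectrally elliptic if $\operatorname{tr} e^{-t\Delta}$ admits an asymptotic expansion $\sum_{i=0}^\infty c_i t^{-s_i}$ as $t \to 0^+$, where the $s_i$ are decreasingly ordered reals. The set $\Pi$ of exponents $s_i$ is called the heat spectrum of $\Delta$. For a finite set of reals $s_0 > \dots > s_k$, $\mathcal{D}(\{s_i\}_{i=0}^k)$ is the set of all spectrally elliptic operators $\Delta$ whose heat spectrum $\Pi$ satisfies $\Pi \cap [s_k,\infty) \subset \{s_i\}_{i=0}^k$, i.e. for which $\operatorname{tr} e^{-t\Delta} = \sum_{i=0}^k c_i t^{-s_i} + O(t^{-s_{k+1}})$ as $t\to 0^+$ for some $s_{k+1} < s_k$ (coefficients $c_i$ may vanish). The function $\zeta(\Delta,s)$ denotes $\operatorname{tr}\Delta^{-s}$ (convergent for $\operatorname{Re} s$ large), and $\Gamma(s)\zeta(\Delta,s)$ is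 understood as its meromorphic continuation; $\operatorname{res}_{s=a}$ is the residue at $s=a$ (zero if there is no pole). $\sigma(\Delta)$ is the spectrum of $\Delta$, consisting of eigenvalues, counted with multiplicities, and for a Borel measurable function $G$, $\operatorname{tr}_\Lambda G(\Delta) = \sum_{\lambda \in \sigma(\Delta)\cap(0,\Lambda]} G(\lambda)$; thus $\operatorname{tr}_\Lambda F(\Delta\,\epsilon) = \sum_{\lambda\in\sigma(\Delta)\cap(0,\Lambda]} F(\epsilon\lambda)$. *)

(* Defs.v *)
From HB Require Import structures.
From mathcomp Require Import all_boot all_order all_algebra.
From mathcomp Require Import all_classical all_reals all_analysis.
From mathcomp Require Export complex.

Set Implicit Arguments.
Unset Strict Implicit.
Unset Printing Implicit Defensive.

Import Order.TTheory GRing.Theory Num.Theory.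
Import numFieldNormedType.Exports.

Local Open Scope classical_set_scope.
Local Open Scope ring_scope.
Local Open Scope complex_scope.

(* Complex Hilbert spaces; the inner product is linear in its first argument. *)
HB.mixin Record isHilbert (R : realType) H of CompleteNormedModule R[i] H := {
  dot : H -> H -> R[i] ;
  dot_linear : forall (a : R[i]) (u v w : H),
    dot (a *: u + v) w = a * dot u w + dot v w ;
  dot_conj : forall u v : H, dot v u = (dot u v)^* ;
  dot_norm : forall u : H, dot u u = `|u| ^+ 2
}.

#[short(type="hilbertType")]
HB.structure Definition Hilbert (R : realType) :=
  {H of CompleteNormedModule R[i] H & isHilbert R H}.

(* A partially defined linear operator: [app] is meaningful on [dom] only. *)
Record operator (R : realType) (H : hilbertType R) := Operator {
  dom : set H ;
  app :> H -> H ;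
  dom0 : dom 0 ;
  dom_linear : forall (a : R[i]) (u v : H),
    dom u -> dom v -> dom (a *: u + v) ;
  app_linear : forall (a : R[i]) (u v : H),
    dom u -> dom v -> app (a *: u + v) = a *: app u + app v
}.

Section Operators.
Variables (R : realType) (H : hilbertType R).
Implicit Types (A : operator H) (B : {linear H -> H}).

(* (v, w) is in the graph of the adjoint of A. *)
Definition adjoint_graph A (v w : H) : Prop :=
  forall u : H, dom A u -> dot (A u) v = dot u w.

Definition self_adjoint A : Prop :=
  closure (dom A) = setT /\
  forall v w : H, adjoint_graph A v w <-> (dom A v /\ A v = w).

(* In the order of R[i], [0 <= z] says that z is real and nonnegative. *)
Definition positive A : Prop := forall v : H, dom A v -> 0 <= dot (A v) v.

Definition unbounded A : Prop :=
  ~ exists M : R, forall v : H, dom A v -> `|A v| <= M%:C * `|v|.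

(* z is in the resolvent set of A, and B = (A - z)^-1. *)
Definition is_resolvent A (z : R[i]) B : Prop :=
  [/\ continuous B,
      forall v : H, dom A (B v) /\ A (B v) - z *: B v = v &
      forall v : H, dom A v -> B (A v - z *: v) = v].

Definition invertible A : Prop := exists B, is_resolvent A 0 B.

Definition compact_operator B : Prop :=
  precompact (B @` [set v : H | `|v| <= 1]).

Definition compact_resolvent A : Prop :=
  exists z B, is_resolvent A z B /\ compact_operator B.

(* The spectrum counted with multiplicities: a real eigenvalue l contributes
   the points (l, 0), ..., (l, d - 1), where d is the dimension of its
   eigenspace.  For a self-adjoint operator with compact resolvent there are
   no other spectral points. *)
Definition spectrum A : set (R * nat) :=
  [set p | exists v : 'I_p.2.+1 -> H,
     (forall c : 'I_p.2.+1 -> R[i],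
        \sum_i c i *: v i = 0 -> forall i, c i = 0) /\
     (forall i, dom A (v i) /\ A (v i) = p.1%:C *: v i)].

(* g(A) is trace class iff [trace_class A g], and [trace A g] is then its
   trace, an absolutely convergent sum over the spectrum. *)
Definition trace_class A (g : R -> R) : Prop :=
  summable (spectrum A) (fun p => (g p.1)%:E).

Definition trace A (g : R -> R) : R :=
  let f (p : R * nat) := (g p.1)%:E in
  fine (esum (spectrum A) (f^\+)%E) - fine (esum (spectrum A) (f^\-)%E).

Definition ctrace_class A (g : R -> R[i]) : Prop :=
  trace_class A (fun l => complex.Re (g l)) /\
  trace_class A (fun l => complex.Im (g l)).

Definition ctrace A (g : R -> R[i]) : R[i] :=
  trace A (fun l => complex.Re (g l)) +i* trace A (fun l => complex.Im (g l)).

(* A finite sum when A has compact resolvent. *)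
Definition truncated_trace A (L : R) (g : R -> R) : R :=
  \sum_(p \in spectrum A `&` [set p | 0 < p.1 <= L]) g p.1.

End Operators.

(* heat t applied to A is e^(-tA). *)
Definition heat (R : realType) (t l : R) : R := expR (- (t * l)).

Section SpectrallyElliptic.
Variables (R : realType) (H : hilbertType R).
Implicit Types A : operator H.

(* The sum over i of c i * t ^ (- s i) is an asymptotic expansion of
   tr e^(-tA) as t -> 0+. A finite expansion is padded with zero
   coefficients. *)
Definition heat_expansion A (c s : nat -> R) : Prop :=
  (forall i j : nat, (i < j)%N -> s j < s i) /\
  forall n : nat,
    (fun t : R => trace A (heat t) - \sum_(i < n) c i * t `^ (- s i))
      =O_ ((0 : R)^'+) (fun t : R => t `^ (- s n)).

Definition spectrally_elliptic A : Prop :=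
  [/\ self_adjoint A, positive A, invertible A, unbounded A &
      compact_resolvent A] /\
  (forall t : R, 0 < t -> trace_class A (heat t)) /\
  exists c s : nat -> R, heat_expansion A c s.

(* The class D({s_0 > ... > s_k}). *)
Definition heat_class (k : nat) (s : 'I_k.+1 -> R) A : Prop :=
  spectrally_elliptic A /\
  exists (c : 'I_k.+1 -> R) (s' : R), s' < s ord_max /\
    (fun t : R => trace A (heat t) - \sum_i c i * t `^ (- s i))
      =O_ ((0 : R)^'+) (fun t : R => t `^ (- s')).

End SpectrallyElliptic.

(* Instantiated at K = R[i]. *)
Section Meromorphic.
Variable K : numFieldType.
Implicit Types f g : K -> K.

Definition holomorphic_at f (p : K) : Prop :=
  \forall z \near p, derivable f z 1.

(* Near p, f is the sum of the principal part with coefficient c j on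
   (z - p)^-(j+1), j < n, and of a holomorphic function. The value of f at p
   is irrelevant. *)
Definition principal_part f (p : K) (n : nat) (c : nat -> K) : Prop :=
  exists g, holomorphic_at g p /\
    \forall z \near p^', f z = \sum_(j < n) c j * (z - p) ^- j.+1 + g z.

Definition meromorphic_at f (p : K) : Prop :=
  exists n c, principal_part f p n c.

(* The case n = 1, c 0 = 0 covers regular points, where the residue is 0. *)
Definition is_residue f (p r : K) : Prop :=
  exists n c, principal_part f p n.+1 c /\ c 0%N = r.

End Meromorphic.

Section ZetaGamma.
Variables (R : realType) (H : hilbertType R).
Implicit Types A : operator H.

(* x ^ z for x > 0. *)
Definition cpow (x : R) (z : R[i]) : R[i] :=
  (x `^ complex.Re z * cos (complex.Im z * ln x)) +i*
  (x `^ complex.Re z * sin (complex.Im z * ln x)).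

(* Euler's integral, used for Re z > 0 only. *)
Definition cGamma (z : R[i]) : R[i] :=
  (\int[lebesgue_measure]_(t in `]0, +oo[)
      (complex.Re (cpow t (z - 1)) * expR (- t))) +i*
  (\int[lebesgue_measure]_(t in `]0, +oo[)
      (complex.Im (cpow t (z - 1)) * expR (- t))).

Definition zeta A (z : R[i]) : R[i] := ctrace A (fun l => cpow l (- z)).

(* r is the residue at a of the meromorphic continuation of
   Gamma(z) zeta(A, z) from the region where Re z is large to a half-plane
   containing a. A half-plane is connected, so r is unique. *)
Definition zeta_Gamma_residue A (a r : R[i]) : Prop :=
  exists (Z : R[i] -> R[i]) (x0 x1 : R),
    [/\ x0 < complex.Re a,
        0 < x1,
        forall z, x0 < complex.Re z -> meromorphic_at Z z,
        forall z, x1 < complex.Re z ->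
          ctrace_class A (fun l => cpow l (- z)) /\
          Z z = zeta A z * cGamma z &
        is_residue Z a r].

End ZetaGamma.

(* Main.v *)
Require Import Defs.
From HB Require Import structures.
From mathcomp Require Import all_boot all_order all_algebra.
From mathcomp Require Import finmap.
From mathcomp Require Import all_classical all_reals all_analysis.
From mathcomp Require Import measurable_realfun.
From mathcomp Require Import ring lra.

Set Implicit Arguments.
Unset Strict Implicit.
Unset Printing Implicit Defensive.

Import Order.TTheory GRing.Theory Num.Theory.
Import numFieldNormedType.Exports.
Import ComplexField.Normc.

Local Open Scope classical_set_scope.
Local Open Scope ring_scope.
Local Open Scope complex_scope.

(** Both sides of the formula are the coefficient [c_k] of [t ^ (- s_k)] in the
expansion of the heat trace [theta t = tr exp(-tA)].

The residue.  For [Re z] large, [Gamma z * l ^ (- z)] is the Mellin transform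
at [z] of [t |-> exp(-tl)].  Summing over the spectrum gives
[Gamma z * zeta A z = mellin theta z] ([zeta_Gamma_mellin]).  Subtract from
[theta] the terms [c_i * t ^ (- s_i)], cut off to [t <= 1].  Each such term
has Mellin transform [c_i / (z - s_i)] ([cintegral_cpow_le1]).  What is left is
[O(t ^ (- s'))] at [0] with [s' < s_k], and decays faster than any power at
infinity because the spectrum has a positive lower bound.  Its Mellin
transform is therefore holomorphic for [Re z > s'] ([mellin_holomorphic]).
So [Gamma * zeta] continues to [Re z > s'] with at most simple poles, at the [s_i], and
residue [c_i] there ([zeta_Gamma_residue_last]).

The limit.  Take [F x = sum_j b_j exp(-a_j x)] with [a_j = exp j], [j <= k].
Then [tr F(tA) = sum_j b_j theta (a_j t)], and the coefficient of
[t ^ (- s_i)] in it is [c_i * sum_j b_j (exp(- s_i)) ^ j].  The nodes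
[exp(- s_i)] are distinct, so Lagrange interpolation provides [b_j] for which
this sum is [1] when [i = k] and [0] otherwise ([lagrange_coefficients]).
Hence [t ^ s_k * tr F(tA)] tends to [c_k] as [t] tends to [0]
([full_trace_estimate]).

The truncation.  For [l > L] and [t = m ln L / L] one has
[exp(-tl) <= L ^ (- (1 - e) m) * exp(-e t l)], so the part of the trace that the
truncation discards is at most a constant times
[L ^ (- (1 - e) m) * theta (e t)] ([tail_estimate]).  Since
[theta t = O(t ^ (- s_0))] and [t >= 1 / L] eventually, after multiplication by
[t ^ s_k] this is [O(L ^ (s_0 - s_k - (1 - e) m))].  The exponent is negative
for [e] small exactly because [m > s_0 - s_k] ([cutoff_trace_cvg]). *)

(** * Real exponential and trigonometric bounds *)

Section Elementary.
Variable R : realType.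
Implicit Types x y : R.

Lemma norm_expR_sub1 x : `|expR x - 1| <= `|x| * expR `|x|.
Proof.
have h := expR_ge1Dx x; have h' := expR_ge1Dx (- x).
have e0 := expR_gt0 x.
have hx : expR x - 1 <= x * expR x.
  have : expR x * (1 - x) <= expR x * expR (- x) by rewrite ler_pM2l.
  rewrite -expRD subrr expR0; lra.
have [x0|x0] := leP 0 x.
  by rewrite (ger0_norm x0) ger0_norm; [exact: hx|lra].
have e1 : 1 <= expR (- x) by rewrite -expR0 ler_expR; lra.
rewrite ler0_norm; last by rewrite subr_le0 -expR0 ler_expR ltW.
rewrite (ltr0_norm x0); nra.
Qed.

Lemma norm_expR_sub1Dx x : `|expR x - 1 - x| <= x ^+ 2 * expR `|x|.
Proof.
have h := expR_ge1Dx x; have e0 := expR_gt0 x.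
have hx : expR x - 1 - x <= x * (expR x - 1).
  have h' := expR_ge1Dx (- x).
  have : expR x * (1 - x) <= expR x * expR (- x) by rewrite ler_pM2l.
  rewrite -expRD subrr expR0; lra.
rewrite ger0_norm; last lra.
apply: (le_trans hx); apply: (le_trans (ler_norm _)).
by rewrite normrM -real_normK ?num_real// expr2 -mulrA ler_wpM2l// norm_expR_sub1.
Qed.

Lemma norm_sin_le y : `|sin y| <= `|y|.
Proof.
wlog y0 : y / 0 <= y.
  move=> h; have [/h//|y0] := leP 0 y.
  by rewrite -normrN -sinN -[leRHS]normrN h// oppr_ge0 ltW.
have [c _] := @MVT_segment R sin cos 0 y y0 (fun x _ => is_derive_sin x)
  (continuous_subspaceT (@continuous_sin R)).
by rewrite sin0 !subr0 => ->; rewrite normrM ler_piMl// cos_max.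
Qed.

Lemma norm_cos_sub1 y : `|cos y - 1| <= y ^+ 2.
Proof.
have -> : y = (y / 2) *+ 2 by rewrite -mulr_natr divfK.
set t := y / 2.
rewrite cos_mulr2n cos2sin2.
have -> : (1 - sin t ^+ 2) *+ 2 - 1 - 1 = - (2 * sin t ^+ 2) by ring.
rewrite normrN normrM ger0_norm// ger0_norm ?sqr_ge0//.
have : sin t ^+ 2 <= t ^+ 2.
  by rewrite -(real_normK (num_real (sin t))) -(real_normK (num_real t)) lerXn2r ?nnegrE// norm_sin_le.
by have := sqr_ge0 t; rewrite mulr2n; nra.
Qed.

Lemma norm_cos_sub1_le y : `|cos y - 1| <= `|y|.
Proof.
wlog y0 : y / 0 <= y.
  move=> h; have [/h//|y0] := leP 0 y.
  by rewrite -cosN -[leRHS]normrN h// oppr_ge0 ltW.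
have [c _] := @MVT_segment R cos (fun x => - sin x) 0 y y0 (fun x _ => is_derive_cos x)
  (continuous_subspaceT (@continuous_cos R)).
by rewrite cos0 subr0 => ->; rewrite normrM normrN ler_piMl// sin_max.
Qed.

Lemma norm_sin_sub y : `|sin y - y| <= y ^+ 2.
Proof.
wlog y0 : y / 0 <= y.
  move=> h; have [/h//|y0] := leP 0 y.
  have := h (- y); rewrite sinN sqrrN -opprD normrN; apply; lra.
have dsin x : is_derive x 1 (fun y => sin y - y) (cos x - 1).
  by apply: is_deriveB.
have cs : continuous (fun y : R => sin y - y).
  by move=> x; apply: cvgB; [exact: continuous_sin|exact: cvg_id].
have [c /andP[c0 cy]] := @MVT_segment R _ _ 0 y y0 (fun x _ => dsin x)
  (continuous_subspaceT cs).
rewrite sin0 subr0 !subr0 => ->; rewrite normrM expr2 (ger0_norm y0) ler_wpM2r//.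
rewrite (le_trans (norm_cos_sub1_le _))// ger0_norm//.
Qed.

(** Logarithms that appear when a power is differentiated in its exponent are
absorbed into an arbitrarily small power. *)
Lemma sqr_le_expR (d x : R) : 0 < d -> x ^+ 2 <= 4 / d ^+ 2 * expR (d * `|x|).
Proof.
move=> d0.
have h := expR_ge1Dx (d * `|x| / 2).
have -> : d * `|x| = d * `|x| / 2 + d * `|x| / 2 by field.
rewrite expRD -(real_normK (num_real x)).
have x0 := normr_ge0 x; set a := `|x| in h x0 *.
have h2 : d * a / 2 <= expR (d * a / 2) by apply: le_trans h; lra.
have h0 : 0 <= d * a / 2 by rewrite divr_ge0// mulr_ge0// ltW.
have := ler_pM h0 h0 h2 h2.
move=> /(ler_wpM2l _) h3.
have /h3 : 0 <= 4 / d ^+ 2 by rewrite divr_ge0// sqr_ge0.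
apply: le_trans.
by rewrite le_eqVlt; apply/orP; left; apply/eqP; field; rewrite gt_eqF.
Qed.

End Elementary.

(** * Complex powers of a positive real *)

Section Cpow.
Variable R : realType.
Implicit Types (x y t : R) (z w : R[i]).

Local Notation Re := (@complex.Re R).
Local Notation Im := (@complex.Im R).

(** Identities in [R[i]] are proved below by comparing real and imaginary
parts, which [ReImE] expands. *)
Lemma complex_ext z w : Re z = Re w -> Im z = Im w -> z = w.
Proof. by case: z w => [a b] [c d] /= -> ->. Qed.

Lemma cReD z w : Re (z + w) = Re z + Re w. Proof. by case: z w => [a b] [c d]. Qed.
Lemma cImD z w : Im (z + w) = Im z + Im w. Proof. by case: z w => [a b] [c d]. Qed.
Lemma cReN z : Re (- z) = - Re z. Proof. by case: z. Qed.
Lemma cImN z : Im (- z) = - Im z. Proof. by case: z. Qed.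
Lemma cReM z w : Re (z * w) = Re z * Re w - Im z * Im w.
Proof. by case: z w => [a b] [c d]. Qed.
Lemma cImM z w : Im (z * w) = Re z * Im w + Im z * Re w.
Proof. by case: z w => [a b] [c d]. Qed.
Lemma cRe1 : Re 1 = 1. Proof. by []. Qed.
Lemma cIm1 : Im 1 = 0. Proof. by []. Qed.
Lemma cRe0 : Re 0 = 0. Proof. by []. Qed.
Lemma cIm0 : Im 0 = 0. Proof. by []. Qed.
Definition ReImE := (cReD, cImD, cReN, cImN, cReM, cImM, cRe1, cIm1, cRe0, cIm0).

Lemma normcE z : normc z = Num.sqrt (Re z ^+ 2 + Im z ^+ 2).
Proof. by case: z. Qed.

Lemma normc_ge0 z : 0 <= normc z. Proof. by rewrite normcE sqrtr_ge0. Qed.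

Lemma norm_complexE z : `|z| = (normc z)%:C.
Proof. by rewrite normc_def normcE. Qed.

Lemma norm_Re_le z : `|Re z| <= normc z.
Proof. by rewrite normcE -sqrtr_sqr ler_wsqrtr// lerDl sqr_ge0. Qed.

Lemma norm_Im_le z : `|Im z| <= normc z.
Proof. by rewrite normcE -sqrtr_sqr ler_wsqrtr// lerDr sqr_ge0. Qed.

Lemma normc_le z : normc z <= `|Re z| + `|Im z|.
Proof.
have a0 := normr_ge0 (Re z); have b0 := normr_ge0 (Im z).
rewrite normcE -[leRHS]ger0_norm ?addr_ge0// -sqrtr_sqr ler_wsqrtr//.
rewrite -(real_normK (num_real (Re z))) -(real_normK (num_real (Im z))).
by rewrite sqrrD; nra.
Qed.

Lemma cnormN z : normc (- z) = normc z.
Proof. by rewrite !normcE cReN cImN !sqrrN. Qed.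

Lemma normc_real x : normc x%:C = `|x|.
Proof. by rewrite normcE /= expr0n addr0 sqrtr_sqr. Qed.

Lemma cpowE t z : 0 < t -> cpow t z =
  (expR (Re z * ln t) * cos (Im z * ln t)) +i* (expR (Re z * ln t) * sin (Im z * ln t)).
Proof. by move=> t0; rewrite /cpow /powR gt_eqF. Qed.

Lemma cpow0 t : 0 < t -> cpow t 0 = 1.
Proof.
by move=> t0; rewrite cpowE//= !mul0r expR0 cos0 sin0 mulr1 mulr0.
Qed.

Lemma cpowD t z w : 0 < t -> cpow t (z + w) = cpow t z * cpow t w.
Proof.
move=> t0; rewrite !cpowE//.
apply: complex_ext; rewrite !ReImE /= !mulrDl expRD ?cosD ?sinD; ring.
Qed.

Lemma cpowM x y z : 0 < x -> 0 < y -> cpow (x * y) z = cpow x z * cpow y z.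
Proof.
move=> x0 y0; rewrite !cpowE ?mulr_gt0//.
rewrite lnM ?posrE//.
by apply: complex_ext; rewrite !ReImE /= !mulrDr expRD ?cosD ?sinD; ring.
Qed.

Lemma cpow_real t x : 0 < t -> cpow t x%:C = (t `^ x)%:C.
Proof. by move=> t0; rewrite /cpow/= mul0r cos0 sin0 mulr1 mulr0. Qed.

Lemma cpow1 t : 0 < t -> cpow t 1 = t%:C.
Proof.
by move=> t0; rewrite -[1]/(1%:C) cpow_real// powRr1// ltW.
Qed.

Lemma normc_cpow t z : 0 < t -> normc (cpow t z) = t `^ Re z.
Proof.
move=> t0; rewrite normcE /= !exprMn -mulrDr cos2Dsin2 mulr1 sqrtr_sqr.
by rewrite ger0_norm// powR_ge0.
Qed.

(** First-order expansion of [w |-> t ^ w] at [0] with an error that is explicit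
in both [w] and [t]: integrated against a weight in [t], it becomes
differentiability of a Mellin transform. *)
Lemma normc_cpow_taylor t w : 0 < t ->
  normc (cpow t w - 1 - (ln t)%:C * w) <=
  4 * normc w ^+ 2 * ln t ^+ 2 * expR (normc w * `|ln t|).
Proof.
move=> t0; rewrite cpowE//; apply: (le_trans (normc_le _)); rewrite !ReImE /=.
set u := ln t; set n := normc w.
have -> : u * Re w - 0 * Im w = Re w * u by ring.
have -> : u * Im w + 0 * Re w = Im w * u by ring.
set x := Re w * u; set y := Im w * u.
have n0 : 0 <= n by exact: normc_ge0.
have xn : `|x| <= n * `|u| by rewrite normrM ler_wpM2r// norm_Re_le.
have yn : `|y| <= n * `|u| by rewrite normrM ler_wpM2r// norm_Im_le.
set v := n * `|u| in xn yn *.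
have -> : 4 * n ^+ 2 * u ^+ 2 = 4 * v ^+ 2.
  by rewrite /v exprMn (real_normK (num_real u)); ring.
have v0 : 0 <= v by exact: mulr_ge0.
have exv : expR `|x| <= expR v by rewrite ler_expR.
have ev1 : 1 <= expR v by rewrite -expR0 ler_expR.
have sq r : `|r| <= v -> r ^+ 2 <= v ^+ 2.
  by move=> rv; rewrite -(real_normK (num_real r)) lerXn2r ?nnegrE.
have x2 := sq _ xn; have y2 := sq _ yn.
have re : `|expR x * cos y - 1 - x| <= 2 * v ^+ 2 * expR v.
  have -> : expR x * cos y - 1 - x = (expR x - 1 - x) + expR x * (cos y - 1) by ring.
  apply: (le_trans (ler_normD _ _)); rewrite normrM ger0_norm ?expR_ge0//.
  have -> : 2 * v ^+ 2 * expR v = v ^+ 2 * expR v + expR v * v ^+ 2 by ring.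
  apply: lerD.
    by apply: (le_trans (norm_expR_sub1Dx x)); apply: ler_pM => //; rewrite ?sqr_ge0 ?expR_ge0.
  apply: ler_pM; rewrite ?expR_ge0//.
    by rewrite ler_expR (le_trans (ler_norm _)).
  exact: (le_trans (norm_cos_sub1 y)).
have im : `|expR x * sin y - 0 - y| <= 2 * v ^+ 2 * expR v.
  have -> : expR x * sin y - 0 - y = (expR x - 1) * sin y + (sin y - y) by ring.
  apply: (le_trans (ler_normD _ _)); rewrite normrM.
  have -> : 2 * v ^+ 2 * expR v = (v * expR v) * v + v ^+ 2 * expR v by ring.
  apply: lerD.
    apply: ler_pM => //; last exact: le_trans (norm_sin_le y) _.
    by apply: (le_trans (norm_expR_sub1 x)); apply: ler_pM => //; rewrite ?expR_ge0.
  apply: (le_trans (norm_sin_sub y)); apply: (le_trans y2).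
  by rewrite ler_peMr// sqr_ge0.
rewrite /= in re im *.
have -> : 4 * v ^+ 2 * expR v = 2 * v ^+ 2 * expR v + 2 * v ^+ 2 * expR v by ring.
exact: lerD.
Qed.

End Cpow.

(** * Integrals of complex functions on the positive half-line *)

Section ComplexIntegral.
Variable R : realType.
Implicit Types (x y t : R) (z w : R[i]) (k : R -> R[i]) (M : R -> R).

Local Notation Re := (@complex.Re R).
Local Notation Im := (@complex.Im R).
Local Notation mu := (@lebesgue_measure R).
Local Notation pos := (`]0, +oo[%classic : set R).

Definition cmeasurable k :=
  measurable_fun pos (fun t => Re (k t)) /\ measurable_fun pos (fun t => Im (k t)).

Definition cintegrable k :=
  mu.-integrable pos (fun t => (Re (k t))%:E) /\
  mu.-integrable pos (fun t => (Im (k t))%:E).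

Definition cintegral k : R[i] :=
  (\int[mu]_(t in pos) Re (k t)) +i* (\int[mu]_(t in pos) Im (k t)).

Lemma measurable_pos : measurable pos. Proof. exact: measurable_itv. Qed.
(** The sigma-algebra carried by Lebesgue measure and the canonical one on [R]
have different displays, so each form of the statement is wanted. *)
Lemma lebesgue_measurable_pos : @measurable _ (measurableTypeR R) pos.
Proof. exact: measurable_itv. Qed.
Hint Resolve measurable_pos lebesgue_measurable_pos : core.
Local Notation mpos := lebesgue_measurable_pos.

Lemma posP t : pos t <-> 0 < t. Proof. by rewrite /= in_itv/= andbT. Qed.

Lemma cmeasurable_real (f : R -> R) : measurable_fun pos f -> cmeasurable (fun t => (f t)%:C).
Proof. by move=> mf; split => //; exact: measurable_cst. Qed.

Lemma cmeasurableM k k' : cmeasurable k -> cmeasurable k' ->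
  cmeasurable (fun t => k t * k' t).
Proof.
move=> [a b] [c d]; split.
  apply: (eq_measurable_fun (fun t => Re (k t) * Re (k' t) - Im (k t) * Im (k' t))).
    by move=> t _; rewrite cReM.
  by apply: measurable_funB; apply: measurable_funM.
apply: (eq_measurable_fun (fun t => Re (k t) * Im (k' t) + Im (k t) * Re (k' t))).
  by move=> t _; rewrite cImM.
by apply: measurable_funD; apply: measurable_funM.
Qed.

Lemma cmeasurable_cpow z : cmeasurable (fun t => cpow t z).
Proof.
have mln : measurable_fun pos (fun t => Im z * ln t).
  by apply: measurable_funM => //; apply: measurable_funTS; exact: measurable_ln.
have mp : measurable_fun pos (fun t => t `^ Re z).
  by apply: measurable_funTS; exact: measurable_powR.
split; apply: measurable_funM => //; apply: measurableT_comp mln => //;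
  apply: continuous_measurable_fun; [exact: continuous_cos|exact: continuous_sin].
Qed.

Lemma eq_cintegral k k' : (forall t, 0 < t -> k t = k' t) -> cintegral k = cintegral k'.
Proof.
move=> h; congr (_ +i* _); apply: eq_Rintegral => t; rewrite inE => /posP t0.
  by rewrite h.
by rewrite h.
Qed.

Lemma eq_cintegrable k k' : (forall t, 0 < t -> k t = k' t) ->
  cintegrable k -> cintegrable k'.
Proof.
move=> h [a b]; split.
  by apply: eq_integrable a => // t; rewrite inE => /posP t0; rewrite h.
by apply: eq_integrable b => // t; rewrite inE => /posP t0; rewrite h.
Qed.

Lemma cintegrable_le k M : cmeasurable k -> mu.-integrable pos (EFin \o M) ->
  (forall t, 0 < t -> normc (k t) <= M t) -> cintegrable k.
Proof.
move=> [mr mi] iM h; split; apply: le_integrable iM => //.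
- exact/measurable_EFinP.
- move=> t /posP t0 /=; rewrite lee_fin (le_trans (norm_Re_le _))//.
  exact: le_trans (h t t0) (ler_norm _).
- exact/measurable_EFinP.
- move=> t /posP t0 /=; rewrite lee_fin (le_trans (norm_Im_le _))//.
  exact: le_trans (h t t0) (ler_norm _).
Qed.

Lemma cintegrableD k k' : cintegrable k -> cintegrable k' ->
  cintegrable (fun t => k t + k' t).
Proof.
move=> [a b] [c d]; split.
  apply: (eq_integrable mpos _ _ _ (integrableD mpos a c)) => // t _.
  by rewrite cReD EFinD.
apply: (eq_integrable mpos _ _ _ (integrableD mpos b d)) => // t _.
by rewrite cImD EFinD.
Qed.

Lemma cintegralD k k' : cintegrable k -> cintegrable k' ->
  cintegral (fun t => k t + k' t) = cintegral k + cintegral k'.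
Proof.
move=> [a b] [c d]; apply: complex_ext; rewrite ReImE/=.
  by under eq_Rintegral do rewrite /= ReImE; rewrite RintegralD.
by under eq_Rintegral do rewrite /= ReImE; rewrite RintegralD.
Qed.

Lemma cintegrableZ w k : cintegrable k -> cintegrable (fun t => w * k t).
Proof.
move=> [a b]; split.
  apply: (eq_integrable mpos _ _ _ (integrableB mpos (integrableZl mpos (Re w) a) (integrableZl mpos (Im w) b))) => // t _.
  by rewrite cReM EFinB !EFinM.
apply: (eq_integrable mpos _ _ _ (integrableD mpos (integrableZl mpos (Re w) b) (integrableZl mpos (Im w) a))) => // t _.
by rewrite cImM EFinD !EFinM.
Qed.

Lemma cintegralZ w k : cintegrable k ->
  cintegral (fun t => w * k t) = w * cintegral k.
Proof.
move=> [a b].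
have Z x f : mu.-integrable pos (EFin \o f) -> mu.-integrable pos (EFin \o (fun t => x * f t)).
  by move=> h; exact: (integrableZl mpos x h).
apply: complex_ext; rewrite ReImE/=.
  under eq_Rintegral do rewrite /= ReImE; rewrite RintegralB ?RintegralZl//; exact: Z.
under eq_Rintegral do rewrite /= ReImE; rewrite RintegralD ?RintegralZl//; exact: Z.
Qed.

Lemma cintegralB k k' : cintegrable k -> cintegrable k' ->
  cintegral (fun t => k t - k' t) = cintegral k - cintegral k'.
Proof.
move=> ik ik'; rewrite -[X in _ - X]mul1r -mulNr -cintegralZ// -cintegralD//; last exact: cintegrableZ.
by apply: eq_cintegral => t _; rewrite mulN1r.
Qed.

Lemma cintegrableB k k' : cintegrable k -> cintegrable k' ->
  cintegrable (fun t => k t - k' t).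
Proof.
move=> ik ik'; apply: (@eq_cintegrable (fun t => k t + (-1) * k' t)).
  by move=> t _; rewrite mulN1r.
by apply: cintegrableD => //; exact: cintegrableZ.
Qed.

Lemma cintegrable_sum (I : Type) (r : seq I) (P : pred I) (k : I -> R -> R[i]) :
  (forall i, P i -> cintegrable (k i)) -> cintegrable (fun t => \sum_(i <- r | P i) k i t).
Proof.
move=> ik; elim: r => [|i r ih].
  apply: (@eq_cintegrable (fun=> 0)); first by move=> t _; rewrite big_nil.
  by split; exact: integrable0.
apply: (@eq_cintegrable (fun t => if P i then k i t + \sum_(j <- r | P j) k j t
  else \sum_(j <- r | P j) k j t)); first by move=> t _; rewrite big_cons.
case: (boolP (P i)) => Pi; last exact: ih.
by apply: cintegrableD ih; exact: ik.
Qed.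

Lemma cintegral_sum (I : Type) (r : seq I) (P : pred I) (k : I -> R -> R[i]) :
  (forall i, P i -> cintegrable (k i)) ->
  cintegral (fun t => \sum_(i <- r | P i) k i t) = \sum_(i <- r | P i) cintegral (k i).
Proof.
move=> ik; elim: r => [|i r ih].
  rewrite big_nil (@eq_cintegral _ (fun=> 0)); last by move=> t _; rewrite big_nil.
  by rewrite /cintegral /= !Rintegral_cst ?mul0r.
rewrite big_cons (@eq_cintegral _ (fun t => if P i then k i t + \sum_(j <- r | P j) k j t
  else \sum_(j <- r | P j) k j t)); last by move=> t _; rewrite big_cons.
case: (boolP (P i)) => Pi; last exact: ih.
by rewrite cintegralD ?ih//; [exact: ik|exact: cintegrable_sum].
Qed.

(** The factor [2] comes from estimating the real and imaginary parts
separately. *)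
Lemma norm_cintegral_le k M : cintegrable k -> mu.-integrable pos (EFin \o M) ->
  (forall t, 0 < t -> normc (k t) <= M t) ->
  normc (cintegral k) <= 2 * \int[mu]_(t in pos) M t.
Proof.
move=> [ir ii] iM h.
have H f : mu.-integrable pos (EFin \o f) -> (forall t, 0 < t -> `|f t| <= M t) ->
    `|\int[mu]_(t in pos) f t| <= \int[mu]_(t in pos) M t.
  move=> jf fM; apply: (le_trans (le_normr_Rintegral _ jf)) => //.
  apply: le_Rintegral => //.
    have := integrable_abse jf; apply: eq_integrable => //.
  by move=> t /posP /fM.
apply: (le_trans (normc_le _)); rewrite mulr_natl mulr2n; apply: lerD; apply: H => //.
  by move=> t t0; apply: le_trans (h t t0); exact: norm_Re_le.
by move=> t t0; apply: le_trans (h t t0); exact: norm_Im_le.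
Qed.

(** Convergence is stated on real and imaginary parts, which are limits in [R]. *)
Lemma cintegral_dominated_cvg (k_ : nat -> R -> R[i]) k M :
  (forall n, cmeasurable (k_ n)) -> cmeasurable k ->
  mu.-integrable pos (EFin \o M) ->
  (forall n t, 0 < t -> normc (k_ n t) <= M t) ->
  (forall t, 0 < t -> Re (k_ n t) @[n --> \oo] --> Re (k t)) ->
  (forall t, 0 < t -> Im (k_ n t) @[n --> \oo] --> Im (k t)) ->
  Re (cintegral (k_ n)) @[n --> \oo] --> Re (cintegral k) /\
  Im (cintegral (k_ n)) @[n --> \oo] --> Im (cintegral k).
Proof.
move=> mk_ mk iM h cr ci.
have H (f_ : nat -> R -> R) (f : R -> R) : (forall n, measurable_fun pos (f_ n)) ->
    measurable_fun pos f -> (forall n t, 0 < t -> `|f_ n t| <= M t) ->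
    (forall t, 0 < t -> f_ n t @[n --> \oo] --> f t) ->
    (\int[mu]_(t in pos) f_ n t) @[n --> \oo] --> \int[mu]_(t in pos) f t.
  move=> mf_ mf fM cf.
  have [|||||i1 _ c1] := @dominated_convergence _ _ _ mu pos mpos
    (fun n t => (f_ n t)%:E) (fun t => (f t)%:E) (EFin \o M) => //.
  - by move=> n; apply/measurable_EFinP; exact: mf_.
  - exact/measurable_EFinP.
  - by apply: aeW => t /posP t0; apply: cvg_EFin; [exact: nearW|exact: cf].
  - by apply: aeW => t n /posP t0 /=; rewrite lee_fin fM.
  - by apply: fine_cvg; rewrite fineK//; exact: integrable_fin_num.
split; apply: H => //.
- by move=> n; case: (mk_ n).
- by case: mk.
- by move=> n t t0; apply: le_trans (h n t t0); exact: norm_Re_le.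
- by move=> n; case: (mk_ n).
- by case: mk.
- by move=> n t t0; apply: le_trans (h n t t0); exact: norm_Im_le.
Qed.

End ComplexIntegral.

(** * Integrable majorants for powers *)

Section PowerIntegrals.
Variable R : realType.
Implicit Types (x y t a b d C : R) (z w : R[i]).

Local Notation Re := (@complex.Re R).
Local Notation Im := (@complex.Im R).
Local Notation mu := (@lebesgue_measure R).
Local Notation pos := (`]0, +oo[%classic : set R).
Local Notation mpos := (@lebesgue_measurable_pos R).

Lemma FTC_pos (F f : R -> R) a b : 0 < a -> a < b ->
  (forall t, 0 < t -> is_derive t 1 F (f t)) ->
  (forall t, 0 < t -> {for t, continuous f}) ->
  (\int[mu]_(t in `[a, b]) (f t)%:E = (F b)%:E - (F a)%:E)%E.
Proof.
move=> a0 ab dF cf.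
have cF t : 0 < t -> {for t, continuous F}.
  by move=> /dF h; apply: differentiable_continuous; apply/derivable1_diffP/ex_derive.
apply: continuous_FTC2 => //.
- apply: continuous_in_subspaceT => t; rewrite inE /= in_itv /= => /andP[at_ _].
  by apply: cf; exact: lt_le_trans at_.
- split.
  + by move=> t; rewrite in_itv/= => /andP[at_ _]; apply: (@ex_derive _ _ _ _ _ _ _ (dF t _)); exact: lt_trans at_.
  + by apply: cvg_at_right_filter; exact: cF.
  + by apply: cvg_at_left_filter; apply: cF; exact: lt_trans ab.
- move=> t; rewrite in_itv/= => /andP[at_ _]; rewrite derive1E.
  by apply: (@derive_val _ _ _ _ _ _ _ (dF t _)); exact: lt_trans at_.
Qed.

Lemma pos_bigcup : pos = \bigcup_n `[n.+1%:R^-1, n.+1%:R]%classic.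
Proof.
apply/seteqP; split => t.
  move=> /posP t0; pose N := Num.truncn (t + t^-1).
  have tN : t + t^-1 < N.+1%:R by rewrite truncnS_gt.
  have ti : 0 < t^-1 by rewrite invr_gt0.
  exists N => //=; rewrite in_itv/=; apply/andP; split; last lra.
  by rewrite -[leRHS]invrK lef_pV2 ?posrE ?ltr0n//; lra.
by move=> [n _] /=; rewrite !in_itv/= andbT => /andP[nt _]; apply: lt_le_trans nt; rewrite invr_gt0.
Qed.

(** On the exhausting intervals [[1/n, n]] the integral is a difference of two
values of [F], hence at most [2 * C]; monotone convergence does the rest. *)
Lemma integrable_antiderivative (F f : R -> R) C :
  (forall t, 0 < t -> 0 <= f t) -> (forall t, 0 < t -> `|F t| <= C) ->
  (forall t, 0 < t -> is_derive t 1 F (f t)) ->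
  (forall t, 0 < t -> {for t, continuous f}) ->
  mu.-integrable pos (EFin \o f).
Proof.
move=> f0 FC dF cf.
have mf : measurable_fun pos f.
  apply: open_continuous_measurable_fun; first exact: interval_open.
  by move=> t; rewrite inE => /posP; exact: cf.
pose I (n : nat) : set (measurableTypeR R) := `[n.+1%:R^-1, n.+1%:R]%classic.
have Ipos n t : I n t -> 0 < t.
  by rewrite /I/= in_itv/= => /andP[nt _]; apply: lt_le_trans nt; rewrite invr_gt0.
have ndI : nondecreasing_seq I.
  move=> n m nm; apply/subsetPset => t; rewrite /I/= !in_itv/= => /andP[nt tn].
  apply/andP; split; last by apply: le_trans tn _; rewrite ler_nat.
  by apply: le_trans nt; rewrite lef_pV2 ?posrE ?ltr0n// ler_nat.
have h := @ge0_nondecreasing_set_cvg_integral _ _ _ I (EFin \o f) mu ndI.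
apply/integrableP; split; first exact/measurable_EFinP.
have -> : (\int[mu]_(x in pos) `|(EFin \o f) x| = \int[mu]_(x in pos) (EFin \o f) x)%E.
  by apply: eq_integral => t; rewrite inE => /posP t0 /=; rewrite ger0_norm ?f0.
apply: (@le_lt_trans _ _ (2 * C)%:E); last exact: ltry.
have {}h : (\int[mu]_(x in I i) (EFin \o f) x @[i --> \oo] --> \int[mu]_(x in \bigcup_i I i) (EFin \o f) x)%E.
  apply: h.
  - by move=> i; exact: measurable_itv.
  - move=> i; apply/measurable_EFinP; apply: measurable_funS mf => // t /Ipos.
    by move=> ?; exact/posP.
  - by move=> i t /Ipos t0; rewrite /= lee_fin f0.
rewrite pos_bigcup -/I -(cvg_lim _ h)//.
apply: lime_le; first by apply/cvg_ex; eexists; exact: h.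
apply: nearW => n; rewrite /I.
have C0 : 0 <= C by apply: le_trans (FC 1 _).
case: n => [|n].
  by rewrite invr1 set_itv1 integral_set1 lee_fin mulr_ge0.
have n0 : 0 < n.+2%:R^-1 :> R by rewrite invr_gt0.
have n1 : n.+2%:R^-1 < n.+2%:R :> R.
  by apply: (@lt_trans _ _ 1); rewrite ?invf_lt1 ?ltr1n.
rewrite (FTC_pos n0 n1 dF cf) -EFinB lee_fin.
have := FC _ n0; have := FC _ (lt_trans n0 n1); rewrite !ler_norml; lra.
Qed.

(** The derivative of [t ^ d / (1 + t ^ d)].  Up to constants it is
[t ^ (d - 1)] near [0] and [t ^ (- d - 1)] near infinity, and it is integrable
for free because its antiderivative is bounded. *)
Definition powR_majorant d t := d * t `^ (d - 1) / (1 + t `^ d) ^+ 2.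

Lemma powR_majorant_ge0 d t : 0 <= d -> 0 <= powR_majorant d t.
Proof. by move=> d0; rewrite divr_ge0 ?sqr_ge0// mulr_ge0// powR_ge0. Qed.

Lemma integrable_powR_majorant d : 0 < d -> mu.-integrable pos (EFin \o powR_majorant d).
Proof.
move=> d0.
have c1 t x : 0 < t -> {for t, continuous (fun t : R => t `^ x)}.
  move=> t0; apply: differentiable_continuous; apply/derivable1_diffP.
  by apply: derivable_powR; rewrite in_itv/= andbT.
have p1 t : 1 + t `^ d != 0 by rewrite gt_eqF// ltr_wpDr// powR_ge0.
(* [- 1 / (1 + t ^ d)] differs from [t ^ d / (1 + t ^ d)] by a constant. *)
apply: (@integrable_antiderivative (fun t => - (1 + t `^ d)^-1) _ 1).
- by move=> t _; exact/powR_majorant_ge0/ltW.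
- move=> t _; rewrite normrN ger0_norm ?invr_ge0 ?addr_ge0 ?powR_ge0//.
  by rewrite invf_le1 ?ltr_wpDr ?powR_ge0// lerDl powR_ge0.
- move=> t t0.
  have h1 : is_derive t 1 (fun t => 1 + t `^ d) (0 + d * t `^ (d - 1)).
    by apply: is_deriveD; exact: is_derive1_powR.
  have h2 := is_deriveV (p1 t : (fun t => 1 + t `^ d) t != 0) h1.
  have h3 := is_deriveN h2.
  apply: (is_derive_eq h3).
  by rewrite /powR_majorant add0r scaleNr opprK /GRing.scale/= mulrC.
- move=> t t0; apply: continuousM.
    by apply: continuousM; [exact: cst_continuous|exact: c1].
  apply: continuousV; first by rewrite expf_neq0.
  apply: (@continuous_comp _ _ _ (fun t => 1 + t `^ d) (fun y => y ^+ 2)); last exact: exprn_continuous.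
  by apply: continuousD; [exact: cst_continuous|exact: c1].
Qed.

Lemma powR_majorant_ge_small d t : 0 < d -> 0 < t <= 1 -> t `^ (d - 1) <= 4 / d * powR_majorant d t.
Proof.
move=> d0 /andP[t0 t1]; rewrite /powR_majorant.
have p0 : 0 <= t `^ d by exact: powR_ge0.
have p1 : t `^ d <= 1.
  by rewrite -[leRHS](powRr0 t) ger_powR ?t0// ltW.
have -> : 4 / d * (d * t `^ (d - 1) / (1 + t `^ d) ^+ 2) =
   t `^ (d - 1) * (4 / (1 + t `^ d) ^+ 2).
  by field; rewrite !gt_eqF// ltr_wpDr.
rewrite ler_peMr ?powR_ge0// ler_pdivlMr ?exprn_gt0 ?ltr_wpDr//.
by rewrite mul1r; nra.
Qed.

Lemma powR_majorant_ge_large d t : 0 < d -> 1 <= t -> t `^ (- d - 1) <= 4 / d * powR_majorant d t.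
Proof.
move=> d0 t1; rewrite /powR_majorant.
have t0 : 0 < t by exact: lt_le_trans t1.
have p1 : 1 <= t `^ d by rewrite -[leLHS](powRr0 t) ler_powR// ltW.
have -> : t `^ (- d - 1) = t `^ (d - 1) / (t `^ d) ^+ 2.
  have tn : t != 0 by rewrite gt_eqF.
  have -> : t `^ (d - 1) = t `^ (- d - 1) * t `^ d * t `^ d.
    by rewrite -!powRD ?tn ?implybT//; congr (_ `^ _); ring.
  by field; rewrite gt_eqF// powR_gt0.
have -> : 4 / d * (d * t `^ (d - 1) / (1 + t `^ d) ^+ 2) =
   t `^ (d - 1) * (4 / (1 + t `^ d) ^+ 2).
  by field; rewrite !gt_eqF//; lra.
apply: ler_wpM2l; first exact: powR_ge0.
rewrite ler_pdivlMr ?exprn_gt0 //; last by lra.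
rewrite mulrC ler_pdivrMr ?exprn_gt0 //; last by lra.
nra.
Qed.

End PowerIntegrals.

(** * Scaling of Lebesgue measure *)

Section Scaling.
Variable R : realType.
Implicit Types (x y t a b d l : R).

Local Notation mu := (@lebesgue_measure R).
Local Notation pos := (`]0, +oo[%classic : set R).
Local Notation mpos := (@lebesgue_measurable_pos R).

Lemma measurable_scaling l : measurable_fun setT ( *%R l : measurableTypeR R -> measurableTypeR R).
Proof. exact: mulrl_measurable. Qed.

(** Both sides are measures, and they agree on the half-open intervals, which
determine Lebesgue measure. *)
Lemma lebesgue_measure_scaling l (l0 : 0 < l) (A : set R) : measurable A ->
  mu A = (l%:E * pushforward mu ( *%R l : measurableTypeR R -> measurableTypeR R) A)%E.
Proof.
move=> mA; pose k : {nonneg R} := NngNum (ltW l0).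
have -> : (l%:E * pushforward mu ( *%R l : measurableTypeR R -> measurableTypeR R) A =
  mscale k (pushforward mu ( *%R l : measurableTypeR R -> measurableTypeR R)) A)%E by [].
have mm := measurable_scaling l.
pose phi := *%R l : measurableTypeR R -> measurableTypeR R.
pose nu : {measure set (measurableTypeR R) -> \bar R} :=
  mscale k (pushforward mu phi).
apply: (@lebesgue_measure_unique R (nu mm) _ A mA) => _ [[a b] _ <-].
have -> : nu mm `]a, b]%classic = (l%:E * mu (phi @^-1` `]a, b]))%E by [].
have -> : phi @^-1` `]a, b] = `](a / l), (b / l)]%classic.
  apply/seteqP; split => x; rewrite /= !in_itv/= ltr_pdivrMr// ler_pdivlMr// [x * l]mulrC//.
rewrite !lebesgue_measure_itv/= !lte_fin ltr_pM2r ?invr_gt0//.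
case: ifPn => _; last by rewrite mule0.
by rewrite -!EFinD -EFinM; congr (_%:E); field; rewrite gt_eqF.
Qed.

Lemma ge0_integral_scaling l (l0 : 0 < l) (f : R -> \bar R) :
  measurable_fun pos f -> (forall x, (0 <= f x)%E) ->
  (\int[mu]_(t in pos) f t = l%:E * \int[mu]_(t in pos) f (l * t)%R)%E.
Proof.
move=> mf f0; pose k : {nonneg R} := NngNum (ltW l0).
have mm := measurable_scaling l.
pose phi := *%R l : measurableTypeR R -> measurableTypeR R.
have e : phi @^-1` pos = pos.
  by apply/seteqP; split => x; rewrite /= !in_itv/= !andbT pmulr_rgt0.
rewrite -[in RHS]e -(@ge0_integral_pushforward _ _ _ _ _ phi mm mu pos f)//.
rewrite -[l in RHS]/(k%:num) -ge0_integral_mscale//.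
by apply: eq_measure_integral => A mA _; exact: lebesgue_measure_scaling.
Qed.

Lemma Rintegral_scaling l (l0 : 0 < l) (f : R -> R) :
  measurable_fun pos f ->
  \int[mu]_(t in pos) f t = l * \int[mu]_(t in pos) f (l * t).
Proof.
move=> mf; have mfE : measurable_fun pos (EFin \o f) by exact/measurable_EFinP.
(* [fine] is [0] at infinite values, so it commutes with scaling there too. *)
have H (A B : \bar R) : fine (l%:E * A - l%:E * B)%E = l * fine (A - B)%E.
  by case: A B => [a||] [b||] //=; rewrite ?gt0_muley ?gt0_muleNy ?lte_fin//= ?mulr0// mulrBr.
rewrite /Rintegral integralE [in RHS]integralE.
rewrite (ge0_integral_scaling l0)//; last exact: measurable_funepos.
rewrite [X in fine (_ - X)%E](ge0_integral_scaling l0)//; last exact: measurable_funeneg.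
by rewrite H; congr (_ * fine (_ - _)%E); apply: eq_integral => t _; rewrite ?funeposE ?funenegE.
Qed.

End Scaling.

(** * Mellin transform of a truncated power *)

Section TruncatedPower.
Variable R : realType.
Implicit Types (x y t a b d l : R) (v w z : R[i]).

Local Notation Re := (@complex.Re R).
Local Notation Im := (@complex.Im R).
Local Notation mu := (@lebesgue_measure R).
Local Notation pos := (`]0, +oo[%classic : set R).
Local Notation mpos := (@lebesgue_measurable_pos R).

Lemma is_derive_cpow w t : 0 < t ->
  is_derive t 1 (fun t => Re (cpow t w)) (Re (w * cpow t (w - 1))) /\
  is_derive t 1 (fun t => Im (cpow t w)) (Im (w * cpow t (w - 1))).
Proof.
move=> t0.
have tn : t != 0 by rewrite gt_eqF.
have tx : t `^ Re w = t * t `^ (Re w - 1).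
  by rewrite -[X in X * _](powRr1 (ltW t0)) -powRD ?tn ?implybT// addrC subrK.
have hp : is_derive t 1 (fun t => t `^ Re w) (Re w * t `^ (Re w - 1)) by exact: is_derive1_powR.
have hl : is_derive t 1 (fun t => Im w * ln t) (Im w * t^-1).
  by apply: is_deriveZ; exact: is_derive1_ln.
have hc : is_derive t 1 (fun t => cos (Im w * ln t)) (- sin (Im w * ln t) * (Im w * t^-1)).
  by have := @is_derive1_comp _ cos (fun t => Im w * ln t) t _ _ (is_derive_cos _) hl.
have hs : is_derive t 1 (fun t => sin (Im w * ln t)) (cos (Im w * ln t) * (Im w * t^-1)).
  by have := @is_derive1_comp _ sin (fun t => Im w * ln t) t _ _ (is_derive_sin _) hl.
split.
  apply: (is_derive_eq (is_deriveM hp hc)).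
  rewrite /GRing.scale/= !ReImE/= !ReImE tx oppr0 addr0; by field.
apply: (is_derive_eq (is_deriveM hp hs)).
rewrite /GRing.scale/= !ReImE/= !ReImE tx oppr0 addr0; by field.
Qed.

Lemma continuous_cpow w t : 0 < t ->
  {for t, continuous (fun t => Re (cpow t w))} /\
  {for t, continuous (fun t => Im (cpow t w))}.
Proof.
move=> t0; have [h1 h2] := is_derive_cpow w t0.
by split; apply: differentiable_continuous; apply/derivable1_diffP/ex_derive.
Qed.

(** [t ^ w / w] is an antiderivative of [t ^ (w - 1)]. *)
Lemma cintegral_cpow_itv w a : w != 0 -> 0 < a -> a < 1 ->
  cintegral (fun t => ((a <= t <= 1)%R%:R)%:C * cpow t (w - 1)) =
  w^-1 * (1 - cpow a w).
Proof.
move=> w0 a0 a1; set v := w^-1.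
have cont (u : R[i]) t : 0 < t -> {for t, continuous (fun t => Re (u * cpow t (w - 1)))} /\
    {for t, continuous (fun t => Im (u * cpow t (w - 1)))}.
  move=> t0; have [c1 c2] := continuous_cpow (w - 1) t0.
  split.
    rewrite (_ : (fun t => _) = (fun t => Re u * Re (cpow t (w - 1)) - Im u * Im (cpow t (w - 1)))); last first.
      by apply/funext => y; rewrite cReM.
    by apply: continuousB; apply: continuousM => //; exact: cst_continuous.
  rewrite (_ : (fun t => _) = (fun t => Re u * Im (cpow t (w - 1)) + Im u * Re (cpow t (w - 1)))); last first.
    by apply/funext => y; rewrite cImM.
  by apply: continuousD; apply: continuousM => //; exact: cst_continuous.
have der t : 0 < t -> is_derive t 1 (fun t => Re (v * cpow t w)) (Re (cpow t (w - 1))) /\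
    is_derive t 1 (fun t => Im (v * cpow t w)) (Im (cpow t (w - 1))).
  move=> t0; have [d1 d2] := is_derive_cpow w t0.
  have e : cpow t (w - 1) = v * (w * cpow t (w - 1)) by rewrite mulrA mulVf// mul1r.
  split.
    rewrite (_ : (fun t => _) = (fun t => Re v * Re (cpow t w) - Im v * Im (cpow t w))); last first.
      by apply/funext => y; rewrite cReM.
    by rewrite e cReM; apply: is_deriveB; apply: is_deriveZ.
  rewrite (_ : (fun t => _) = (fun t => Re v * Im (cpow t w) + Im v * Re (cpow t w))); last first.
    by apply/funext => y; rewrite cImM.
  by rewrite e cImM; apply: is_deriveD; apply: is_deriveZ.
have red (f F : R -> R) : (forall t, 0 < t -> is_derive t 1 F (f t)) ->
    (forall t, 0 < t -> {for t, continuous f}) ->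
    \int[mu]_(t in pos) ((a <= t <= 1)%R%:R * f t) = F 1 - F a.
  move=> dF cf.
  rewrite (_ : _ - _ = \int[mu]_(t in `[a, 1]) f t); last by rewrite /Rintegral (FTC_pos a0 a1 dF cf).
  have -> : `[a, 1]%classic = pos `&` `[a, 1]%classic.
    apply/seteqP; split => [t h|t []//]; split => //; apply/posP.
    by move: h; rewrite /= in_itv/= => /andP[h _]; exact: lt_le_trans h.
  rewrite Rintegral_mkcondr; apply: eq_Rintegral => t _.
  rewrite patchE mem_setE in_itv/=.
  by case: ifPn => _; rewrite ?mul1r ?mul0r.
have one : cpow 1 w = 1 by rewrite cpowE// ln1 !mulr0 expR0 cos0 sin0 mulr1 mulr0.
have cont1 t : 0 < t -> {for t, continuous (fun t => Re (cpow t (w - 1)))} /\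
    {for t, continuous (fun t => Im (cpow t (w - 1)))} by move=> t0; exact: continuous_cpow.
have -> : v * (1 - cpow a w) = v * cpow 1 w - v * cpow a w by rewrite one mulrBr.
apply: complex_ext.
  rewrite cReD cReN; apply: etrans (red _ _ (fun t h => (der t h).1) (fun t h => (cont1 t h).1)).
  by apply: eq_Rintegral => t _; rewrite cReM /= mul0r subr0.
rewrite cImD cImN; apply: etrans (red _ _ (fun t h => (der t h).2) (fun t h => (cont1 t h).2)).
by apply: eq_Rintegral => t _; rewrite cImM /= mul0r addr0.
Qed.

Lemma measurable_le1 : measurable_fun pos (fun t => (t <= 1)%R%:R : R).
Proof.
apply: (@eq_measurable_fun _ _ _ _ pos (\1_(`]-oo, 1]%classic : set R) : R -> R)); last first.
  by apply: measurable_indic; exact: measurable_itv.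
by move=> t _; rewrite indicE mem_setE in_itv.
Qed.

Lemma measurable_itv1 a : measurable_fun pos (fun t => (a <= t <= 1)%R%:R : R).
Proof.
apply: (@eq_measurable_fun _ _ _ _ pos (\1_(`[a, 1]%classic : set R) : R -> R)); last first.
  by apply: measurable_indic; exact: measurable_itv.
by move=> t _; rewrite indicE mem_setE in_itv.
Qed.

Lemma cvg_Re_Im (u : nat -> R[i]) (l : R[i]) (e : nat -> R) :
  (forall n, normc (u n - l) <= e n) -> e n @[n --> \oo] --> (0 : R) ->
  Re (u n) @[n --> \oo] --> Re l /\ Im (u n) @[n --> \oo] --> Im l.
Proof.
move=> ue e0.
have H (f : nat -> R) x : (forall n, `|f n - x| <= e n) -> f n @[n --> \oo] --> x.
  move=> fe; apply/cvgrPdist_le => eps eps0.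
  have h : \forall n \near \oo, `|0 - e n| <= eps by move/cvgrPdist_le: e0; apply.
  apply: filterS h => n; rewrite sub0r normrN => en.
  by rewrite distrC (le_trans (fe n))// (le_trans (ler_norm _)).
split; apply: H => n; apply: le_trans (ue n).
  by rewrite -cReN -cReD norm_Re_le.
by rewrite -cImN -cImD norm_Im_le.
Qed.

Lemma powR_majorant_bound_ge0 d : 0 < d -> forall t, 0 <= 4 / d * powR_majorant d t.
Proof.
by move=> d0 t; apply: mulr_ge0; [apply: divr_ge0 => //|apply: powR_majorant_ge0]; exact: ltW.
Qed.

Lemma cintegrable_cpow_le1 w : 0 < Re w ->
  cintegrable (fun t => ((t <= 1)%R%:R)%:C * cpow t (w - 1)).
Proof.
move=> w0; have M0 := powR_majorant_bound_ge0 w0.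
apply: (@cintegrable_le _ _ (fun t => 4 / Re w * powR_majorant (Re w) t)).
- by apply: cmeasurableM; [apply: cmeasurable_real; exact: measurable_le1|exact: cmeasurable_cpow].
- exact: (integrableZl mpos (4 / Re w) (integrable_powR_majorant w0)).
- move=> t t0; rewrite normcM normc_real normc_cpow// !ReImE.
  have [t1|t1] := leP t 1.
    by rewrite normr1 mul1r; apply: powR_majorant_ge_small => //; rewrite t0.
  by rewrite normr0 mul0r.
Qed.

(** Let the lower end of the interval tend to [0]: there [t ^ w] vanishes since
[0 < Re w], and dominated convergence applies.  This is the source of every
pole in the continuation. *)
Lemma cintegral_cpow_le1 w : 0 < Re w ->
  cintegral (fun t => ((t <= 1)%R%:R)%:C * cpow t (w - 1)) = w^-1.
Proof.
move=> w0; have M0 := powR_majorant_bound_ge0 w0.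
have wn : w != 0 by apply: contraTneq w0 => ->; rewrite ltxx.
pose k_ n t := ((n.+2%:R^-1 <= t <= 1)%R%:R)%:C * cpow t (w - 1).
have ind n t : 0 < t -> t^-1 <= n.+2%:R -> k_ n t = ((t <= 1)%R%:R)%:C * cpow t (w - 1).
  move=> t0 tn; rewrite /k_; congr ((_%:R)%:C * _).
  have -> // : n.+2%:R^-1 <= t by rewrite -[leRHS]invrK lef_pV2 ?posrE ?invr_gt0 ?ltr0n.
have ev t : 0 < t -> \forall n \near \oo, k_ n t = ((t <= 1)%R%:R)%:C * cpow t (w - 1).
  move=> t0; near=> n; apply: ind => //.
  apply: ltW; apply: (lt_le_trans (truncnS_gt _)); rewrite ler_nat.
  near: n; exists (Num.truncn t^-1) => // n /= Nn; rewrite ltnS; exact: leqW.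
have [cr ci] : Re (cintegral (k_ n)) @[n --> \oo] --> Re (cintegral (fun t => ((t <= 1)%R%:R)%:C * cpow t (w - 1))) /\
   Im (cintegral (k_ n)) @[n --> \oo] --> Im (cintegral (fun t => ((t <= 1)%R%:R)%:C * cpow t (w - 1))).
  apply: (@cintegral_dominated_cvg _ _ _ (fun t => 4 / Re w * powR_majorant (Re w) t)).
  - by move=> n; apply: cmeasurableM; [apply: cmeasurable_real; exact: measurable_itv1|exact: cmeasurable_cpow].
  - by apply: cmeasurableM; [apply: cmeasurable_real; exact: measurable_le1|exact: cmeasurable_cpow].
  - exact: (integrableZl mpos (4 / Re w) (integrable_powR_majorant w0)).
  - move=> n t t0; rewrite normcM normc_real normc_cpow// !ReImE.
    have [/andP[_ t1]|_] := boolP (_ <= t <= 1); last by rewrite normr0 mul0r.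
    by rewrite normr1 mul1r; apply: powR_majorant_ge_small => //; rewrite t0.
  - by move=> t t0; apply: cvg_near_cst; apply: filterS (ev t t0) => n ->.
  - by move=> t t0; apply: cvg_near_cst; apply: filterS (ev t t0) => n ->.
have val n : cintegral (k_ n) = w^-1 * (1 - cpow n.+2%:R^-1 w).
  by rewrite cintegral_cpow_itv// ?invr_gt0// invf_lt1// ltr1n.
have c0 : (n.+2%:R^-1 : R) `^ Re w @[n --> \oo] --> (0 : R).
  apply: (cvg_comp (fun n => n.+2%:R^-1) (fun a : R => a `^ Re w) _ (powR_cvg0 w0)).
  have h : (n.+2%:R^-1 : R) @[n --> \oo] --> (0 : R).
    by rewrite (@cvg_shiftS _ (@harmonic R)); exact: cvg_harmonic.
  move=> A [e e0 eA]; have h' : \forall n \near \oo, `|0 - n.+2%:R^-1 : R| < e by move/cvgrPdist_lt: h; apply.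
  by apply: filterS h' => n en; apply: eA => //=; rewrite invr_gt0.
have [vr vi] : Re (cintegral (k_ n)) @[n --> \oo] --> Re w^-1 /\
    Im (cintegral (k_ n)) @[n --> \oo] --> Im w^-1.
  apply: (@cvg_Re_Im _ _ (fun n => normc w^-1 * n.+2%:R^-1 `^ Re w)).
    move=> n; rewrite val mulrBr mulr1 addrAC subrr sub0r cnormN normcM.
    by rewrite normc_cpow// invr_gt0.
  by rewrite -[X in _ --> X](mulr0 (normc w^-1)); exact: cvgMl_tmp.
by apply: complex_ext; [exact: (cvg_unique _ cr vr)|exact: (cvg_unique _ ci vi)].
Unshelve. all: end_near. Qed.

End TruncatedPower.

(** * Holomorphy over a numeric field *)

Section Holomorphic.
Variable K : numFieldType.
Implicit Types (f g : K -> K) (p z c s : K).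

Lemma near_norm_lt p (e : K) (P : K -> Prop) : 0 < e ->
  (forall z, `|p - z| < e -> P z) -> \forall z \near p, P z.
Proof. by move=> e0 h; exists e. Qed.

(** A quadratic error bound is all that differentiability needs, and unlike a
limit it can be read off an integral estimate. *)
Lemma derivable_taylor f p (D d C : K) : 0 < d -> 0 <= C ->
  (forall w, `|w| <= d -> `|f (p + w) - f p - w * D| <= C * `|w| ^+ 2) ->
  derivable f p 1.
Proof.
move=> d0 C0 h.
have C1 : 0 < C + 1 by rewrite ltr_wpDl.
apply/cvg_ex; exists D; apply/cvgrPdist_le => e e0.
near=> q.
have q0 : q != 0 by near: q; exact: nbhs_dnbhs_neq.
have nq0 : 0 < `|q| by rewrite normr_gt0.
have qd : `|q| <= d by near: q; exact: dnbhs0_le.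
have qe : `|q| <= e / (C + 1) by near: q; apply: dnbhs0_le; rewrite divr_gt0.
have := h q qd; rewrite /GRing.scale /= mulr1 [q + p]addrC => hq.
have -> : D - q^-1 * (f (p + q) - f p) = - (q^-1 * (f (p + q) - f p - q * D)).
  by field.
rewrite normrN normrM normfV ler_pdivrMl// (le_trans hq)// expr2 mulrCA.
rewrite ler_wpM2l// (@le_trans _ _ ((C + 1) * `|q|))//.
  by rewrite ler_wpM2r// lerDl.
by rewrite mulrC -ler_pdivlMr.
Unshelve. all: end_near. Qed.

Lemma holomorphic_taylor f p (e : K) : 0 < e ->
  (forall z, `|p - z| < e -> exists D d C : K, [/\ 0 < d, 0 <= C &
    forall w, `|w| <= d -> `|f (z + w) - f z - w * D| <= C * `|w| ^+ 2]) ->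
  holomorphic_at f p.
Proof.
move=> e0 h; apply: near_norm_lt e0 _ => z /h[D [d [C [d0 C0 {}h]]]].
exact: derivable_taylor h.
Qed.

Lemma holomorphic_cst c p : holomorphic_at (fun=> c) p.
Proof.
by rewrite /holomorphic_at; near=> z; exact: derivable_cst.
Unshelve. all: end_near. Qed.

Lemma holomorphicD f g p : holomorphic_at f p -> holomorphic_at g p ->
  holomorphic_at (fun z => f z + g z) p.
Proof.
move=> hf hg; rewrite /holomorphic_at; near=> z.
by apply: derivableD; near: z.
Unshelve. all: end_near. Qed.

Lemma holomorphic_sum (I : Type) (r : seq I) (P : pred I) (f : I -> K -> K) p :
  (forall i, P i -> holomorphic_at (f i) p) ->
  holomorphic_at (fun z => \sum_(i <- r | P i) f i z) p.
Proof.
move=> hf; elim: r => [|i r ih].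
  rewrite (_ : (fun z => _) = fun=> 0); first exact: holomorphic_cst.
  by apply/funext => z; rewrite big_nil.
rewrite (_ : (fun z => _) = fun z => if P i then f i z + \sum_(j <- r | P j) f j z
  else \sum_(j <- r | P j) f j z); last by apply/funext => z; rewrite big_cons.
case: (boolP (P i)) => // Pi; apply: holomorphicD => //; exact: hf.
Qed.

Lemma holomorphic_div c s p : p != s -> holomorphic_at (fun z => c / (z - s)) p.
Proof.
move=> ps; have h : \forall z \near p, z != s.
  apply: (@near_norm_lt _ `|p - s|); first by rewrite normr_gt0 subr_eq0.
  by move=> z; apply: contraTneq => ->; rewrite ltxx.
rewrite /holomorphic_at; near=> z; have zs : z != s by near: z.
apply: derivableM; first exact: derivable_cst.
apply: derivableV; first by rewrite subr_eq0.
by apply: derivableB; [exact: derivable_id|exact: derivable_cst].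
Unshelve. all: end_near. Qed.

End Holomorphic.

(** * Mellin transforms *)

Section Mellin.
Variable R : realType.
Implicit Types (x y t a b d l : R) (v w z p : R[i]) (f g : R -> R).

Local Notation Re := (@complex.Re R).
Local Notation Im := (@complex.Im R).
Local Notation mu := (@lebesgue_measure R).
Local Notation pos := (`]0, +oo[%classic : set R).
Local Notation mpos := (@lebesgue_measurable_pos R).

Definition mellin f z : R[i] := cintegral (fun t => (f t)%:C * cpow t (z - 1)).

Lemma cGamma_mellin z : cGamma z = mellin (fun t => expR (- t)) z.
Proof.
apply: complex_ext => /=; apply: eq_Rintegral => t _; rewrite !ReImE /=; ring.
Qed.

(** The Mellin transform of such an [f] converges, and is holomorphic, for
[a < Re z]: only the growth at [0] limits the half-plane, because the
decay at infinity beats every power. *)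
Definition mellin_strip a f : Prop :=
  [/\ measurable_fun pos f,
      exists C, forall t, 0 < t -> t <= 1 -> `|f t| <= C * t `^ (- a) &
      forall b, exists C, forall t, 1 <= t -> `|f t| <= C * t `^ (- b)].

(** The slack [x - a] leaves room for a factor [expR (2 * d * `|ln t|)], the
larger of [t ^ (2d)] and [t ^ (- 2d)].  It pays for moving the exponent by up
to [d] and for two factors [ln t]. *)
Lemma mellin_strip_dominated a f x : mellin_strip a f -> a < x ->
  exists d C, [/\ 0 < d, 0 <= C, d < x - a & forall t, 0 < t ->
    `|f t| * t `^ (x - 1) * expR ((2 * d) * `|ln t|) <= C * powR_majorant (2 * d) t].
Proof.
move=> [_ [C1 h1] h2] ax; pose d := (x - a) / 4.
have d0 : 0 < d by rewrite divr_gt0// subr_gt0.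
(* This decay makes the product at most a constant times [t ^ (- 2d - 1)] for
   [1 <= t]. *)
have [C2 {}h2] := h2 (x + 4 * d).
have C10 : 0 <= C1.
  by have := h1 1 ltr01 (lexx _); rewrite powR1 mulr1; exact: le_trans.
have C20 : 0 <= C2.
  by have := h2 1 (lexx _); rewrite powR1 mulr1; exact: le_trans.
have d20 : 0 < 2 * d by rewrite mulr_gt0.
have M0 := powR_majorant_bound_ge0 d20.
exists d, ((C1 + C2) * (4 / (2 * d))); split => //.
- by rewrite mulr_ge0// ?addr_ge0// divr_ge0// ltW.
- rewrite /d ltr_pdivrMr//; lra.
move=> t t0; rewrite -mulrA -[leRHS]mulrA.
have tn r s : t `^ r * t `^ s = t `^ (r + s).
  by rewrite powRD// (gt_eqF t0) implybT.
have e0 : 0 <= t `^ (x - 1) * expR (2 * d * `|ln t|).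
  by rewrite mulr_ge0 ?powR_ge0 ?expR_ge0.
have [t1|t1] := leP t 1.
  have -> : expR (2 * d * `|ln t|) = t `^ (- (2 * d)).
    rewrite /powR gt_eqF// mulNr -mulrN ler0_norm//; exact: ln_le0.
  have := ler_wpM2r e0 (h1 t t0 t1).
  have -> : expR (2 * d * `|ln t|) = t `^ (- (2 * d)).
    rewrite /powR gt_eqF// mulNr -mulrN ler0_norm//; exact: ln_le0.
  move=> /le_trans; apply; rewrite -mulrA !tn.
  have -> : - a + (x - 1 - 2 * d) = 2 * d - 1 by rewrite /d; field.
  apply: ler_pM; rewrite ?powR_ge0//; first by rewrite lerDl.
  by apply: powR_majorant_ge_small => //; rewrite t0.
have t1' := ltW t1.
have ee : expR (2 * d * `|ln t|) = t `^ (2 * d).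
  by rewrite /powR gt_eqF// ger0_norm//; exact: ln_ge0.
have := ler_wpM2r e0 (h2 t t1'); rewrite ee.
move=> /le_trans; apply; rewrite -mulrA !tn.
have -> : - (x + 4 * d) + (x - 1 + 2 * d) = - (2 * d) - 1 by rewrite /d; field.
apply: ler_pM; rewrite ?powR_ge0//; first by rewrite lerDr.
exact: powR_majorant_ge_large.
Qed.

Lemma mellin_strip_majorant a f x : mellin_strip a f -> a < x ->
  exists2 M : R -> R, mu.-integrable pos (EFin \o M) &
    forall t, 0 < t -> `|f t| * t `^ (x - 1) <= M t.
Proof.
move=> sf ax; have [d [C [d0 C0 _ h]]] := mellin_strip_dominated sf ax.
have d20 : 0 < 2 * d by rewrite mulr_gt0.
exists (fun t => C * powR_majorant (2 * d) t).
  exact: (integrableZl mpos C (integrable_powR_majorant d20)).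
move=> t t0; apply: le_trans (h t t0); rewrite ler_peMr// ?mulr_ge0 ?powR_ge0//.
by rewrite -[leLHS]expR0 ler_expR; apply: mulr_ge0 => //; exact: ltW.
Qed.

Lemma mellin_cintegrable a f z : mellin_strip a f -> a < Re z ->
  cintegrable (fun t => (f t)%:C * cpow t (z - 1)).
Proof.
move=> sf az; have [M iM h] := mellin_strip_majorant sf az; have [mf _ _] := sf.
apply: cintegrable_le iM _.
  by apply: cmeasurableM; [exact: cmeasurable_real|exact: cmeasurable_cpow].
by move=> t t0; rewrite normcM normc_real normc_cpow// !ReImE; exact: h.
Qed.

(** The derivative in [z] brings down a factor [ln t].  The Taylor remainder of
[t ^ w], weighted by [f t * t ^ (p - 1)], is at most [normc w ^+ 2] times a
fixed integrable function. *)
Lemma mellin_taylor a f p : mellin_strip a f -> a < Re p ->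
  exists d K, 0 < d /\ 0 <= K /\ forall w, normc w <= d ->
    normc (mellin f (p + w) - mellin f p - w * mellin (fun t => ln t * f t) p)
    <= K * normc w ^+ 2.
Proof.
move=> sf ap; have [d [C [d0 C0 dx h]]] := mellin_strip_dominated sf ap.
have d20 : 0 < 2 * d by rewrite mulr_gt0.
have [mf _ _] := sf.
have iC := integrable_powR_majorant d20.
have iln : cintegrable (fun t => (ln t * f t)%:C * cpow t (p - 1)).
  apply: (@cintegrable_le _ _ (fun t => (2 * d)^-1 * C * powR_majorant (2 * d) t)).
  - apply: cmeasurableM; last exact: cmeasurable_cpow.
    apply: cmeasurable_real; apply: measurable_funM => //.
    by apply: measurable_funTS; exact: measurable_ln.
  - exact: (integrableZl mpos ((2 * d)^-1 * C) iC).
  move=> t t0; rewrite normcM normc_real normc_cpow// !ReImE.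
  rewrite -mulrA; apply: le_trans (ler_wpM2l _ (h t t0)); last by rewrite invr_ge0 ltW.
  set E := expR _.
  have -> : `|ln t * f t| * t `^ (Re p - 1) = `|f t| * t `^ (Re p - 1) * `|ln t|.
    by rewrite normrM; ring.
  rewrite [leRHS]mulrCA ler_wpM2l ?mulr_ge0 ?powR_ge0//.
  rewrite -(ler_pM2l d20) mulrA mulfV ?gt_eqF// mul1r.
  by apply: le_trans (expR_ge1Dx _); rewrite lerDr.
(* [4] from [normc_cpow_taylor] times [4 / d ^+ 2] from [sqr_le_expR]. *)
pose c := 16 / d ^+ 2 * C.
exists d, (2 * \int[mu]_(t in pos) (c * powR_majorant (2 * d) t)); split => //.
have ic : mu.-integrable pos (EFin \o (fun t => c * powR_majorant (2 * d) t)).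
  exact: (integrableZl mpos c iC).
have c0 : 0 <= c by rewrite mulr_ge0// divr_ge0// sqr_ge0.
split.
  rewrite mulr_ge0//; apply: Rintegral_ge0 => t _.
  by rewrite mulr_ge0// powR_majorant_ge0// ltW.
move=> w wd; set n := normc w.
have n0 : 0 <= n by exact: normc_ge0.
have apw : a < Re (p + w).
  rewrite cReD; have := norm_Re_le w; rewrite ler_norml => /andP[].
  rewrite -/n in wd *; lra.
have i1 := mellin_cintegrable sf apw.
have i2 := mellin_cintegrable sf ap.
rewrite /mellin -cintegralZ// -!cintegralB//; last 2 first.
- exact: cintegrableB.
- exact: cintegrableZ.
rewrite mulrC mulrCA -RintegralZl//.
apply: norm_cintegral_le.
- by apply: cintegrableB; [exact: cintegrableB|exact: cintegrableZ].
- exact: (integrableZl mpos (n ^+ 2) ic).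
move=> t t0.
have -> : (f t)%:C * cpow t (p + w - 1) - (f t)%:C * cpow t (p - 1) -
     w * ((ln t * f t)%:C * cpow t (p - 1)) =
   (f t)%:C * cpow t (p - 1) * (cpow t w - 1 - (ln t)%:C * w).
  have -> : (ln t * f t)%:C = (ln t)%:C * (f t)%:C by exact: rmorphM.
  rewrite [p + w - 1]addrAC (cpowD (p - 1) w t0); ring.
rewrite normcM normcM normc_real normc_cpow// !ReImE.
apply: le_trans (ler_wpM2l _ (normc_cpow_taylor w t0)) _.
  by rewrite mulr_ge0// powR_ge0.
rewrite -/n /c.
have -> : n ^+ 2 * (16 / d ^+ 2 * C * powR_majorant (2 * d) t) =
  (n ^+ 2 * (16 / d ^+ 2)) * (C * powR_majorant (2 * d) t) by ring.
apply: le_trans (ler_wpM2l _ (h t t0)); last first.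
  by rewrite mulr_ge0 ?sqr_ge0// divr_ge0// sqr_ge0.
set F := `|f t| * _; have F0 : 0 <= F by rewrite mulr_ge0// powR_ge0.
rewrite [leRHS]mulrCA ler_wpM2l//.
have -> : expR (2 * d * `|ln t|) = expR (d * `|ln t|) * expR (d * `|ln t|).
  by rewrite -expRD; congr expR; ring.
have -> : 4 * n ^+ 2 * ln t ^+ 2 * expR (n * `|ln t|) =
  n ^+ 2 * (4 * (ln t ^+ 2 * expR (n * `|ln t|))) by ring.
have -> : n ^+ 2 * (16 / d ^+ 2) * (expR (d * `|ln t|) * expR (d * `|ln t|)) =
  n ^+ 2 * (4 * (4 / d ^+ 2 * expR (d * `|ln t|) * expR (d * `|ln t|))) by field; rewrite gt_eqF.
rewrite ler_wpM2l ?sqr_ge0// ler_wpM2l//.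
apply: ler_pM; rewrite ?sqr_ge0 ?expR_ge0 ?sqr_le_expR//.
by rewrite ler_expR ler_wpM2r.
Qed.

Lemma mellin_holomorphic a f p : mellin_strip a f -> a < Re p ->
  holomorphic_at (mellin f) p.
Proof.
move=> sf ap; apply: (@holomorphic_taylor _ _ _ (Re p - a)%:C).
  by rewrite ltcR subr_gt0.
move=> z; rewrite norm_complexE ltcR => pz.
have az : a < Re z.
  by have := norm_Re_le (p - z); rewrite cReD cReN ler_norml => /andP[_]; lra.
have [d [C [d0 [C0 h]]]] := mellin_taylor sf az.
exists (mellin (fun t => ln t * f t) z), d%:C, C%:C; split.
- by rewrite ltcR.
- by rewrite lecR.
- move=> w; rewrite !norm_complexE lecR => /h; rewrite -lecR => /le_trans; apply.
  by rewrite rmorphM rmorphXn.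
Qed.

End Mellin.

(** * Finite sums over sets *)

Section FsumReal.
Variables (R : realType) (T : choiceType).
Implicit Types (X Y : set T) (f g : T -> R).

Lemma ler_fsum X f g : finite_set X -> (forall i, X i -> f i <= g i) ->
  \sum_(i \in X) f i <= \sum_(i \in X) g i.
Proof.
by move=> fX fg; rewrite -lee_fin -!fsumEFin//; apply: lee_fsum => // i /fg.
Qed.

Lemma norm_fsum_le X f : finite_set X ->
  `|\sum_(i \in X) f i| <= \sum_(i \in X) `|f i|.
Proof. by move=> fX; rewrite !fsbig_finite//; exact: ler_norm_sum. Qed.

(** Truncated traces at two levels differ by the sum over the layer between
them. *)
Lemma fsum_setD X Y f : finite_set Y -> X `<=` Y ->
  \sum_(i \in Y) f i - \sum_(i \in X) f i = \sum_(i \in Y `&` ~` X) f i.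
Proof.
by move=> fY XY; rewrite (fsbigID X _ _ fY)/= setIC (setIidl XY) addrAC subrr add0r.
Qed.

Lemma ler_fsum_subset X Y f : finite_set Y -> X `<=` Y ->
  (forall i, Y i -> 0 <= f i) -> \sum_(i \in X) f i <= \sum_(i \in Y) f i.
Proof.
move=> fY XY f0; rewrite -subr_ge0 fsum_setD//; apply: fsumr_ge0 => i [Yi _].
exact: f0.
Qed.

Lemma fsum_le_esum (S : set T) X f : finite_set X -> X `<=` S ->
  ((\sum_(i \in X) f i)%:E <= esum S (fun i => (f i)%:E))%E.
Proof.
move=> fX XS; rewrite -fsumEFin//; apply: ereal_sup_ubound; exists X => //.
Qed.

End FsumReal.

(** * A positive lower bound of the spectrum *)

Section SpectralGap.
Variables (R : realType) (H : hilbertType R) (A : operator H).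
Local Notation Re := (@complex.Re R).

(** The first of the independent eigenvectors is nonzero. *)
Lemma spectrum_eigenvector p : spectrum A p ->
  exists v : H, [/\ v != 0, dom A v & A v = p.1%:C *: v].
Proof.
move=> [v [free eig]]; exists (v ord0); have [dv Av] := eig ord0; split => //.
apply/eqP => v0; have := free (fun i => (i == ord0)%:R) _ ord0; rewrite eqxx => h.
have /eqP : (1 : R[i]) = 0.
  apply: h; rewrite big1// => i _; have [->|_] := eqVneq i ord0; last by rewrite scale0r.
  by rewrite v0 scaler0.
by rewrite oner_eq0.
Qed.

(** An eigenvalue [l] of [A] gives the eigenvalue [1 / l] of the bounded inverse
[B], so [1 / l] is at most the norm of [B]; positivity excludes [l < 0]. *)
Lemma spectrum_gap : positive A -> invertible A ->
  exists2 m : R, 0 < m & forall p, spectrum A p -> m <= p.1.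
Proof.
move=> posA [B [cB _ BA]].
have := cB 0; move=> /cvgrPdist_lt /(_ 1 ltr01).
move=> /nbhs_ballP[d /= d0 hd].
have dE : d = (Re d)%:C by rewrite RRe_real// gtr0_real.
have d0' : 0 < Re d by move: d0; rewrite dE ltcR.
exists (Re d / 2); first by rewrite divr_gt0.
move=> p /spectrum_eigenvector[v [v0 dv Av]]; set l := p.1 in Av *.
have nv : 0 < `|v| by rewrite normr_gt0.
have l0 : 0 <= l.
  have := posA v dv; rewrite Av -[_ *: v]addr0 dot_linear.
  have d00 : dot 0 v = 0.
    have h := @dot_linear _ H 1 0 0 v; rewrite scaler0 addr0 mul1r in h.
    by apply: (@addrI _ (dot 0 v)); rewrite addr0 -h.
  by rewrite d00 addr0 dot_norm pmulr_lge0 ?exprn_gt0// lecR.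
have lB : l%:C *: B v = v.
  by have := BA v dv; rewrite scale0r subr0 Av linearZ.
rewrite leNgt; apply/negP => ld.
have lC : 0 <= l%:C by rewrite lecR.
pose u := ((Re d / 2)%:C / `|v|) *: v.
have nu : `|u| = (Re d / 2)%:C.
  rewrite normrZ normrM normfV normr_id mulfVK ?gt_eqF// ger0_norm// lecR.
  by rewrite divr_ge0// ltW.
have : `|B 0 - B u| < 1.
  apply: hd; rewrite -ball_normE/= sub0r normrN nu dE ltcR.
  by rewrite ltr_pdivrMr// ltr_pMr// ltr1n.
rewrite linear0 sub0r normrN => Bu.
have : l%:C *: B u = u.
  by rewrite /u; set c := (X in X *: v); rewrite linearZ scalerA mulrC -scalerA lB.
move/(congr1 Num.norm); rewrite normrZ nu (ger0_norm lC) => e.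
have : l%:C * `|B u| <= l%:C * 1 by rewrite ler_wpM2l// ltW.
by rewrite e mulr1 lecR leNgt ld.
Qed.

End SpectralGap.

(** * Traces as limits of truncated traces *)

Section Traces.
Variables (R : realType) (H : hilbertType R) (A : operator H) (m : R).
Hypotheses (m_gt0 : 0 < m) (gap : forall p, spectrum A p -> m <= p.1).
Hypothesis heat_tc : forall t : R, 0 < t -> trace_class A (heat t).
Implicit Types (f g h : R -> R) (t x L : R).

Local Notation S := (spectrum A).
Definition low_spectrum L := S `&` [set p | 0 < p.1 <= L].
Local Notation E := low_spectrum.

Lemma heat_gt0 t l : 0 < heat t l. Proof. exact: expR_gt0. Qed.

Lemma low_spectrumE L p : E L p <-> S p /\ p.1 <= L.
Proof.
split=> [[Sp /andP[]]//|[Sp pL]]; split => //=.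
by rewrite pL (lt_le_trans m_gt0)// gap.
Qed.

Lemma low_spectrum_sub L L' : L <= L' -> E L `<=` E L'.
Proof.
move=> LL p /low_spectrumE[Sp pL]; apply/low_spectrumE; split => //.
exact: le_trans LL.
Qed.

(** Every point below [L] contributes at least [exp(- L)] to the convergent sum
[tr exp(-A)]. *)
Lemma finite_low_spectrum L : finite_set (E L).
Proof.
apply: contrapT => infE.
have tc := heat_tc ltr01; rewrite /trace_class summableE in tc.
set s := esum _ _ in tc.
have bound (X : set (R * nat)) : finite_set X -> X `<=` E L ->
    \sum_(p \in X) heat 1 p.1 <= fine s.
  move=> fX XE; rewrite -lee_fin fineK//.
  have -> : s = esum S (fun p => (heat 1 p.1)%:E).
    by apply: eq_esum => p _ /=; rewrite gtr0_norm ?heat_gt0.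
  by apply: fsum_le_esum => // p /XE[].
pose N := Num.truncn (fine s * expR L).
have [X XE NX] := infinite_set_fset N.+1 infE.
have := bound [set` X] (finite_fset X) XE; apply/negP; rewrite -ltNge.
rewrite fsbig_finite// set_fsetK.
apply: (@lt_le_trans _ _ (N.+1%:R * expR (- L))).
  by rewrite expRN ltr_pdivlMr ?expR_gt0// truncnS_gt.
apply: (@le_trans _ _ (\sum_(p <- X) expR (- L))).
  rewrite big_const_seq count_predT iter_addr_0 -[leRHS]mulr_natl ler_wpM2r ?expR_ge0//.
  by rewrite ler_nat.
rewrite big_seq [leRHS]big_seq; apply: ler_sum => p pX.
have /low_spectrumE[_ pL] := XE p pX.
by rewrite /heat mul1r ler_expR lerN2.
Qed.
Hint Resolve finite_low_spectrum : core.

Lemma truncated_trace_ge0 L g : (forall l, m <= l -> 0 <= g l) -> 0 <= truncated_trace A L g.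
Proof. by move=> g0; apply: fsumr_ge0 => p [Sp _]; exact/g0/gap. Qed.

Lemma truncated_traceD L g h :
  truncated_trace A L (fun l => g l + h l) = truncated_trace A L g + truncated_trace A L h.
Proof. by rewrite /truncated_trace fsbig_split//=; exact: finite_low_spectrum. Qed.

Lemma truncated_traceZ L x g :
  truncated_trace A L (fun l => x * g l) = x * truncated_trace A L g.
Proof. by rewrite /truncated_trace mulr_fsumr. Qed.

Lemma le_truncated_trace L g h : (forall l, m <= l -> g l <= h l) ->
  truncated_trace A L g <= truncated_trace A L h.
Proof.
move=> gh; apply: ler_fsum (finite_low_spectrum L) _ => p [Sp _]; exact/gh/gap.
Qed.

Lemma truncated_trace_nondecreasing g L L' : (forall l, m <= l -> 0 <= g l) -> L <= L' ->
  truncated_trace A L g <= truncated_trace A L' g.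
Proof.
move=> g0 LL; apply: ler_fsum_subset (finite_low_spectrum L') _ _.
  exact: low_spectrum_sub.
by move=> p [Sp _]; exact/g0/gap.
Qed.

Lemma finite_sub_low_spectrum (X : set (R * nat)) : finite_set X -> X `<=` S ->
  exists L, X `<=` E L.
Proof.
move=> fX XS; exists (\sum_(p \in X) p.1) => p Xp; apply/low_spectrumE.
split; first exact: XS.
rewrite (fsbigD1 p)//= lerDl; apply: fsumr_ge0 => q [Xq _].
by apply: (@le_trans _ _ m); [exact: ltW|exact/gap/XS].
Qed.

(** Every finite part of the spectrum lies below some level. *)
Lemma trace_class_bounded g C :
  (forall L, truncated_trace A L (fun l => `|g l|) <= C) -> trace_class A g.
Proof.
move=> gC; apply: (@le_lt_trans _ _ C%:E); last exact: ltry.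
apply: ge_ereal_sup => _ [X [fX XS] <-].
have [L XL] := finite_sub_low_spectrum fX XS.
rewrite fsumEFin//= lee_fin; apply: le_trans (gC L).
by apply: ler_fsum_subset (finite_low_spectrum L) XL _ => p _; exact: normr_ge0.
Qed.

Lemma trace_class_truncated_le g L : trace_class A g ->
  truncated_trace A L (fun l => `|g l|) <= fine (esum S (fun p => `|(g p.1)%:E|%E)).
Proof.
rewrite /trace_class summableE => tc; rewrite -lee_fin fineK//.
apply: (@fsum_le_esum _ _ S _ (fun p => `|g p.1|) (finite_low_spectrum L)) => p [].
done.
Qed.

Lemma trace_class_le g h C : (forall l, m <= l -> `|g l| <= C * `|h l|) ->
  trace_class A h -> trace_class A g.
Proof.
move=> gh tch; have hb L := trace_class_truncated_le L tch.
have C0 L : truncated_trace A L (fun l => `|g l|) <= `|C| * truncated_trace A L (fun l => `|h l|).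
  rewrite -truncated_traceZ; apply: le_truncated_trace => l /gh /le_trans; apply.
  by rewrite ler_wpM2r// ler_norm.
apply: (trace_class_bounded (C := `|C| * fine (esum S (fun p => `|(h p.1)%:E|%E)))) => L.
by apply: (le_trans (C0 L)); rewrite ler_wpM2l.
Qed.

Lemma ge0_truncated_trace_cvg (F : R * nat -> R) :
  (forall p, S p -> 0 <= F p) -> esum S (fun p => (F p)%:E) \is a fin_num ->
  (\sum_(p \in E L) F p) @[L --> +oo] --> fine (esum S (fun p => (F p)%:E)).
Proof.
move=> F0 sfin; set s := esum _ _ in sfin *.
have ub L : \sum_(p \in E L) F p <= fine s.
  by rewrite -lee_fin fineK//; apply: fsum_le_esum => // p [].
apply/cvgrPdist_le => e e0.
have [_ [X [fX XS] <-] sX] := ub_ereal_sup_adherent e0 sfin.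
rewrite -/(esum _ _) -/s -(fineK sfin) fsumEFin// -EFinB lte_fin in sX.
have [L0 XL] := finite_sub_low_spectrum fX XS.
near=> L; have L0L : L0 <= L by near: L; apply: nbhs_pinfty_ge; exact: num_real.
have XE : \sum_(p \in X) F p <= \sum_(p \in E L) F p.
  apply: ler_fsum_subset (finite_low_spectrum L) _ _; last by move=> p [Sp _]; exact: F0.
  exact: subset_trans XL (low_spectrum_sub L0L).
have := ub L; rewrite ger0_norm ?subr_ge0//; lra.
Unshelve. all: end_near. Qed.

(** This reduces algebra and order of traces, which are differences of
suprema, to finite sums. *)
Lemma truncated_trace_cvg g : trace_class A g ->
  truncated_trace A L g @[L --> +oo] --> trace A g.
Proof.
move=> tc; set f := fun p : R * nat => (g p.1)%:E.
pose gp (p : R * nat) := Order.max (g p.1) 0; pose gm (p : R * nat) := Order.max (- g p.1) 0.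
have fp : (f^\+)%E = fun p => (gp p)%:E by apply/funext => p; rewrite /gp EFin_max unlock.
have fm : (f^\-)%E = fun p => (gm p)%:E by apply/funext => p; rewrite /gm EFin_max unlock.
have fin (k : R * nat -> R) : (forall p, 0 <= k p <= `|g p.1|) ->
    esum S (fun p => (k p)%:E) \is a fin_num.
  move=> kg; rewrite ge0_fin_numE; last first.
    by apply: esum_ge0 => p _; rewrite lee_fin; case/andP: (kg p).
  apply: le_lt_trans tc; apply: le_esum => p _.
  by rewrite /= lee_fin; case/andP: (kg p).
have gpb p : 0 <= gp p <= `|g p.1| by rewrite /gp le_max lexx orbT/= ge_max ler_norm/=.
have gmb p : 0 <= gm p <= `|g p.1|.
  by rewrite /gm le_max lexx orbT/= ge_max -normrN ler_norm/=.
have -> : trace A g = fine (esum S (fun p => (gp p)%:E)) - fine (esum S (fun p => (gm p)%:E)).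
  by rewrite -fp -fm.
(* [gp] and [gm] are the positive and negative parts of [g] along the spectrum. *)
have -> : truncated_trace A ^~ g =
    fun L => \sum_(p \in E L) gp p - \sum_(p \in E L) gm p.
  apply/funext => L; apply/eqP; rewrite eq_sym subr_eq eq_sym; apply/eqP.
  rewrite /truncated_trace -fsbig_split/=; last exact: finite_low_spectrum.
  apply: eq_fsbigr => p _ /=.
  by rewrite /gp /gm; case: leP => h1; case: leP => h2; lra.
apply: cvgB; apply: ge0_truncated_trace_cvg; rewrite ?fin//.
  by move=> p _; case/andP: (gpb p).
by move=> p _; case/andP: (gmb p).
Qed.

Lemma trace_unique g x : trace_class A g ->
  truncated_trace A L g @[L --> +oo] --> x -> trace A g = x.
Proof. by move=> /truncated_trace_cvg h; exact: cvg_unique. Qed.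

Lemma traceZ x g : trace_class A g -> trace A (fun l => x * g l) = x * trace A g.
Proof.
move=> tc; apply: trace_unique.
  apply: (trace_class_le (h := g) (C := `|x|)) tc => l _; by rewrite normrM.
have -> : truncated_trace A ^~ (fun l => x * g l) = fun L => x * truncated_trace A L g.
  by apply/funext => L; exact: truncated_traceZ.
by apply: cvgMl_tmp; exact: truncated_trace_cvg.
Qed.

Lemma trace_classD g h : trace_class A g -> trace_class A h ->
  trace_class A (fun l => g l + h l).
Proof.
move=> tg th.
apply: (trace_class_bounded (C := fine (esum S (fun p => `|(g p.1)%:E|%E)) +
  fine (esum S (fun p => `|(h p.1)%:E|%E)))) => L.
apply: (@le_trans _ _ (truncated_trace A L (fun l => `|g l| + `|h l|))).
  by apply: le_truncated_trace => l _; exact: ler_normD.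
by rewrite truncated_traceD; apply: lerD; exact: trace_class_truncated_le.
Qed.

Lemma traceD g h : trace_class A g -> trace_class A h ->
  trace A (fun l => g l + h l) = trace A g + trace A h.
Proof.
move=> tg th; apply: trace_unique; first exact: trace_classD.
have -> : truncated_trace A ^~ (fun l => g l + h l) =
    fun L => truncated_trace A L g + truncated_trace A L h.
  by apply/funext => L; exact: truncated_traceD.
by apply: cvgD; exact: truncated_trace_cvg.
Qed.

Lemma trace_sum (I : Type) (r : seq I) (g : I -> R -> R) :
  (forall i, trace_class A (g i)) ->
  trace_class A (fun l => \sum_(i <- r) g i l) /\
  trace A (fun l => \sum_(i <- r) g i l) = \sum_(i <- r) trace A (g i).
Proof.
move=> tg; elim: r => [|i r [ih1 ih2]].
  have -> : (fun l => \sum_(i <- [::]) g i l) = fun=> 0.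
    by apply/funext => l; rewrite big_nil.
  have tc0 : trace_class A (fun=> 0).
    by apply: (trace_class_bounded (C := 0)) => L; rewrite /truncated_trace fsbig1// => p _; rewrite normr0.
  split => //; rewrite big_nil; apply: trace_unique => //.
  by apply: cvg_near_cst; apply: nearW => L; rewrite /truncated_trace fsbig1.
have -> : (fun l => \sum_(i <- i :: r) g i l) = fun l => g i l + \sum_(i <- r) g i l.
  by apply/funext => l; rewrite big_cons.
split; first exact: trace_classD.
by rewrite traceD// big_cons ih2.
Qed.

Lemma le_trace g h : trace_class A g -> trace_class A h ->
  (forall l, m <= l -> g l <= h l) -> trace A g <= trace A h.
Proof.
move=> tg th gh; apply: ler_cvg_to (truncated_trace_cvg tg) (truncated_trace_cvg th) _.
by apply: nearW => L; exact: le_truncated_trace.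
Qed.

Lemma truncated_trace_le_trace g L : trace_class A g -> (forall l, m <= l -> 0 <= g l) ->
  truncated_trace A L g <= trace A g.
Proof.
move=> tg g0; apply: ler_cvg_to (cvg_cst (truncated_trace A L g)) (truncated_trace_cvg tg) _.
near=> L'; have LL : L <= L' by near: L'; apply: nbhs_pinfty_ge; exact: num_real.
exact: truncated_trace_nondecreasing.
Unshelve. all: end_near. Qed.

(** The trace is the limit of truncated traces, and between the levels [L] and
[L'] these differ by a sum on which [h] dominates [g]. *)
Lemma trace_tail_le g h L : trace_class A g -> trace_class A h ->
  (forall l, m <= l -> 0 <= h l) -> (forall l, L < l -> `|g l| <= h l) ->
  `|trace A g - truncated_trace A L g| <= trace A h.
Proof.
move=> tg th h0 gh.
have cl : `|truncated_trace A L' g - truncated_trace A L g| @[L' --> +oo] -->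
    `|trace A g - truncated_trace A L g|.
  by apply: cvg_norm; apply: cvgB; [exact: truncated_trace_cvg|exact: cvg_cst].
apply: ler_cvg_to cl (truncated_trace_cvg th) _.
near=> L'; have LL : L <= L' by near: L'; apply: nbhs_pinfty_ge; exact: num_real.
have fE := finite_low_spectrum L'.
have fI : finite_set (E L' `&` ~` E L) by exact: finite_setIl.
rewrite /truncated_trace (fsum_setD _ fE (low_spectrum_sub LL)).
apply: (le_trans (norm_fsum_le _ fI)).
apply: (@le_trans _ _ (\sum_(p \in E L' `&` ~` E L) h p.1)).
  apply: ler_fsum => // p [[Sp _] nE]; apply: gh.
  by rewrite ltNge; apply/negP => pL; apply: nE; apply/low_spectrumE.
apply: ler_fsum_subset fE _ _; first by move=> p [].
by move=> p [Sp _]; exact/h0/gap.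
Unshelve. all: end_near. Qed.

End Traces.

(** * Decay estimates *)

Section Decay.
Variable R : realType.
Implicit Types (t x b m d : R).

(** For [0 < b], [b * ln t <= m * t + b * ln (b / m)], because
[ln y <= y] at [y = t * m / b]. *)
Lemma expR_decay m b : 0 < m -> exists2 C : R, 0 <= C &
  forall t, 1 <= t -> expR (- (m * t)) <= C * t `^ (- b).
Proof.
move=> m0; have [b0|b0] := leP b 0.
  exists 1 => // t t1; rewrite mul1r; apply: (@le_trans _ _ 1).
    rewrite -expR0 ler_expR oppr_le0 mulr_ge0 ?ltW//.
    by apply: lt_le_trans t1.
  by rewrite -[leLHS](powRr0 t) ler_powR// oppr_ge0.
exists (expR (b * ln (b / m))); first exact: expR_ge0.
move=> t t1; have t0 : 0 < t by exact: lt_le_trans t1.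
rewrite /powR gt_eqF// -expRD ler_expR mulNr.
have tmb : 0 < t * (m / b) by rewrite mulr_gt0// divr_gt0.
have -> : ln t = ln (t * (m / b)) + ln (b / m).
  rewrite -lnM ?posrE ?divr_gt0//; congr ln; field.
  by rewrite !gt_eqF.
have h : b * ln (t * (m / b)) <= b * (t * (m / b)).
  apply: ler_wpM2l; first exact: ltW.
  by rewrite -ler_expR lnK ?posrE//; apply: le_trans (expR_ge1Dx _); rewrite lerDr.
have e : b * (t * (m / b)) = m * t by field; rewrite gt_eqF.
rewrite e in h; lra.
Qed.

Lemma powR_le_segment t d a : 0 < d -> d <= t -> t <= 1 -> t `^ a <= 1 + d `^ a.
Proof.
move=> d0 dt t1; have t0 : 0 < t by exact: lt_le_trans dt.
have da : 0 <= d `^ a by exact: powR_ge0.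
have [a0|a0] := leP 0 a.
  apply: (@le_trans _ _ 1); last by rewrite lerDl.
  by rewrite -[leRHS](powRr0 t) ger_powR ?t0.
apply: (@le_trans _ _ (d `^ a)); last by rewrite lerDr.
rewrite -[a]opprK ![_ `^ (- - a)]powRN lef_pV2 ?posrE ?powR_gt0//.
by apply: ge0_ler_powR => //; rewrite ?nnegrE ?oppr_ge0; exact: ltW.
Qed.

Lemma powR_bound_ext (f : R -> R) a C M d : 0 < d -> 0 <= M -> 0 <= C ->
  (forall t, 0 < t -> t < d -> `|f t| <= C * t `^ (- a)) ->
  (forall t, d <= t -> t <= 1 -> `|f t| <= M) ->
  exists C', forall t, 0 < t -> t <= 1 -> `|f t| <= C' * t `^ (- a).
Proof.
move=> d0 M0 C0 h1 h2; exists (C + M * (1 + d `^ a)) => t t0 t1.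
have da : 0 <= d `^ a by exact: powR_ge0.
have [td|dt] := ltP t d.
  apply: (le_trans (h1 t t0 td)); rewrite ler_wpM2r ?powR_ge0// lerDl mulr_ge0//.
  by rewrite addr_ge0.
apply: (le_trans (h2 t dt t1)).
have ta : t `^ a <= 1 + d `^ a by exact: powR_le_segment.
rewrite powRN ler_pdivlMr ?powR_gt0//.
apply: (@le_trans _ _ (M * (1 + d `^ a))); first by rewrite ler_wpM2l.
by rewrite lerDr.
Qed.

End Decay.

(** * The heat trace *)

Section HeatTrace.
Variables (R : realType) (H : hilbertType R) (A : operator H) (m : R).
Hypotheses (m_gt0 : 0 < m) (gap : forall p, spectrum A p -> m <= p.1).
Hypothesis heat_tc : forall t : R, 0 < t -> trace_class A (heat t).
Implicit Types (f g h : R -> R) (t x L a : R).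

Local Notation pos := (`]0, +oo[%classic : set R).
Local Notation theta := (fun t => trace A (heat t)).

Lemma heat_ge0 t l : 0 <= heat t l. Proof. exact: expR_ge0. Qed.

Lemma heat_trace_ge0 t : 0 < t -> 0 <= theta t.
Proof.
move=> t0; apply: le_trans (truncated_trace_le_trace m_gt0 gap heat_tc 0 (heat_tc t0) _).
  by apply: (truncated_trace_ge0 gap) => l _; exact: heat_ge0.
by move=> l _; exact: heat_ge0.
Qed.

Lemma truncated_heat_le t L : 0 < t -> truncated_trace A L (heat t) <= theta t.
Proof.
move=> t0; apply: (truncated_trace_le_trace m_gt0 gap heat_tc _ (heat_tc t0)) => l _.
exact: heat_ge0.
Qed.

Lemma heat_trace_nonincreasing t u : 0 < t -> t <= u -> theta u <= theta t.
Proof.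
move=> t0 tu; have u0 : 0 < u by exact: lt_le_trans tu.
apply: (le_trace m_gt0 gap heat_tc) => //; [exact: heat_tc|exact: heat_tc|] => l ml.
by rewrite ler_expR lerN2 ler_wpM2r// (le_trans _ ml)// ltW.
Qed.

(** On the spectrum [l >= m], so [exp(- t l) <= exp(- l) * exp(- m (t - 1))]. *)
Lemma heat_trace_decay t : 1 <= t -> theta t <= theta 1 * expR m * expR (- (m * t)).
Proof.
move=> t1; have t0 : 0 < t by exact: lt_le_trans t1.
rewrite -mulrA mulrC -(traceZ m_gt0 gap heat_tc) //; last exact: heat_tc.
apply: (le_trace m_gt0 gap heat_tc).
- exact: heat_tc.
- apply: (trace_class_le m_gt0 gap heat_tc (h := heat 1) (C := `|expR m * expR (- (m * t))|)).
    by move=> l _; rewrite normrM.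
  exact: heat_tc.
move=> l ml; rewrite /heat -!expRD ler_expR; nra.
Qed.

Lemma measurable_truncated_heat L : measurable_fun pos (fun t => truncated_trace A L (heat t)).
Proof.
have -> : (fun t => truncated_trace A L (heat t)) =
    fun t => \sum_(p <- fset_set (low_spectrum A L)) heat t p.1.
  apply/funext => t; rewrite /truncated_trace fsbig_finite//.
  exact: (finite_low_spectrum m_gt0 gap heat_tc).
apply: measurable_sum => p; apply: measurableT_comp => //.
by apply: measurableT_comp => //; apply: measurable_funM.
Qed.

Lemma truncated_heat_cvg t : 0 < t ->
  truncated_trace A n%:R (heat t) @[n --> \oo] --> theta t.
Proof.
move=> t0; have h := truncated_trace_cvg m_gt0 gap heat_tc (heat_tc t0).
exact: (cvg_comp (fun n => n%:R) (fun L => truncated_trace A L (heat t)) cvgr_idn h).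
Qed.

(** A pointwise limit of finite sums of exponentials. *)
Lemma measurable_heat_trace : measurable_fun pos theta.
Proof.
apply: (@measurable_fun_cvg _ _ _ pos (fun n t => truncated_trace A n%:R (heat t))).
  by move=> n; exact: measurable_truncated_heat.
by move=> t /posP t0; exact: truncated_heat_cvg.
Qed.

Lemma heat_trace_fast_decay b : exists C, forall t, 1 <= t -> `|theta t| <= C * t `^ (- b).
Proof.
have [C C0 hC] := expR_decay b m_gt0.
exists (theta 1 * expR m * C) => t t1.
have t0 : 0 < t by exact: lt_le_trans t1.
rewrite ger0_norm ?heat_trace_ge0//; apply: (le_trans (heat_trace_decay t1)).
rewrite -[leRHS]mulrA ler_wpM2l ?hC// mulr_ge0 ?expR_ge0//.
exact: heat_trace_ge0.
Qed.

Lemma heat_trace_strip a C d : 0 < d -> 0 <= C ->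
  (forall t, 0 < t -> t < d -> theta t <= C * t `^ (- a)) ->
  mellin_strip a theta.
Proof.
move=> d0 C0 h; split; [exact: measurable_heat_trace| |exact: heat_trace_fast_decay].
apply: (@powR_bound_ext _ _ _ C (theta d) d) => //; first exact: heat_trace_ge0.
  by move=> t t0 td; rewrite ger0_norm ?heat_trace_ge0// h.
move=> t dt _; have t0 : 0 < t by exact: lt_le_trans dt.
by rewrite ger0_norm ?heat_trace_ge0// heat_trace_nonincreasing.
Qed.

End HeatTrace.

(** * The Gamma function as a Mellin transform *)

Section GammaHeat.
Variable R : realType.
Implicit Types (t x l : R) (z w : R[i]).
Local Notation Re := (@complex.Re R).
Local Notation Im := (@complex.Im R).
Local Notation mu := (@lebesgue_measure R).
Local Notation pos := (`]0, +oo[%classic : set R).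
Local Notation mpos := (@lebesgue_measurable_pos R).

Lemma cintegral_scaling l (k : R -> R[i]) : 0 < l -> cmeasurable k ->
  cintegral k = l%:C * cintegral (fun t => k (l * t)).
Proof.
move=> l0 [mr mi]; apply: complex_ext; rewrite ?cReM ?cImM /=.
  by rewrite mul0r subr0 (Rintegral_scaling l0 mr).
by rewrite mul0r addr0 (Rintegral_scaling l0 mi).
Qed.

Lemma measurable_heat l : measurable_fun pos (fun t => heat t l).
Proof.
apply: measurableT_comp => //.
by apply: measurableT_comp => //; apply: measurable_funM.
Qed.

Lemma heat_strip l : 0 < l -> mellin_strip 0 (fun t => heat t l).
Proof.
move=> l0; split; first exact: measurable_heat.
  exists 1 => t t0 _; rewrite oppr0 powRr0 mulr1 ger0_norm ?expR_ge0//.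
  by rewrite -[leRHS]expR0 ler_expR oppr_le0 mulr_ge0// ltW.
move=> b; have [C C0 h] := expR_decay b l0; exists C => t t1.
by rewrite ger0_norm ?expR_ge0// /heat mulrC h.
Qed.

(** Substitute [t := l * t] in Euler's integral. *)
Lemma mellin_heat l z : 0 < l -> 0 < Re z ->
  mellin (fun t => heat t l) z = cpow l (- z) * cGamma z.
Proof.
move=> l0 z0; rewrite cGamma_mellin /mellin.
have h1 : cmeasurable (fun t => (expR (- t))%:C * cpow t (z - 1)).
  apply: cmeasurableM; last exact: cmeasurable_cpow.
  by apply: cmeasurable_real; apply: measurableT_comp.
rewrite (cintegral_scaling l0 h1).
have -> : cintegral (fun t => (expR (- (l * t)))%:C * cpow (l * t) (z - 1)) =
   cintegral (fun t => cpow l (z - 1) * ((heat t l)%:C * cpow t (z - 1))).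
  apply: eq_cintegral => t t0; rewrite cpowM// /heat [t * l]mulrC mulrCA; ring.
rewrite cintegralZ; last exact: mellin_cintegrable (heat_strip l0) z0.
rewrite !mulrA -(cpow1 l0) -!cpowD//.
have -> : - z + 1 + (z - 1) = 0 by ring.
by rewrite cpow0// mul1r.
Qed.

(** On [[1, 2]] the integrand is at least [exp(- 2)]. *)
Lemma cGamma_neq0 x : 1 <= x -> cGamma x%:C != 0.
Proof.
move=> x1; have x0 : 0 < x by exact: lt_le_trans x1.
have st : mellin_strip 0 (fun t => expR (- t) : R).
  by have := heat_strip (ltr01 : 0 < 1 :> R); under eq_fun do rewrite /heat mulr1.
have [ir _] := mellin_cintegrable (z := x%:C) st x0.
suff : 0 < Re (cGamma x%:C) by apply: contraTneq => ->; rewrite ltxx.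
rewrite cGamma_mellin /=.
pose I : set (measurableTypeR R) := `[1, 2]%classic; pose ind : R -> R := \1_I.
have mI : measurable I by exact: measurable_itv.
have muI : (mu I = 1%:E)%E.
  rewrite /I lebesgue_measure_itv/= lte_fin ltr1n -EFinB; congr _%:E; ring.
have I12 : mu.-integrable pos (EFin \o ind).
  apply/integrableP; split.
    by exact/measurable_EFinP/measurable_indic.
  have -> : (\int[mu]_(t in pos) `|(EFin \o ind) t| =
      \int[mu]_(t in pos) (ind t)%:E)%E.
    by apply: eq_integral => t _ /=; rewrite ger0_norm.
  rewrite integral_indic//.
  apply: le_lt_trans (_ : (mu I < +oo)%E); last first.
    by rewrite muI ltry.
  by apply: le_measure; rewrite ?inE//; apply: measurableI.
apply: (@lt_le_trans _ _ (\int[mu]_(t in pos) (expR (- 2) * (ind t)))).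
  rewrite RintegralZl// mulr_gt0 ?expR_gt0//.
  rewrite /Rintegral integral_indic//.
  have -> : I `&` pos = I.
    apply/setIidl => t; rewrite /I /= !in_itv/= andbT => /andP[h _].
    by apply: lt_le_trans h.
  by rewrite [X in fine X](_ : _ = 1%:E).
apply: le_Rintegral => //.
  exact: (integrableZl mpos (expR (- 2)) I12).
move=> t /posP t0; rewrite [0 - 0]subrr !mul0r subr0 cos0 mulr1.
rewrite /ind indicE; case: (boolP (t \in _)) => [|_]; last first.
  by rewrite mulr0 mulr_ge0 ?expR_ge0 ?powR_ge0.
rewrite mem_setE in_itv/= => /andP[t1 t2]; rewrite mulr1.
rewrite -[leLHS]mulr1 ler_pM ?expR_ge0// ?ler_expR ?lerN2//.
by rewrite -[leLHS](powRr0 t) ler_powR// subr_ge0.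
Qed.

End GammaHeat.

(** * The zeta function as a Mellin transform *)

Section ZetaMellin.
Variables (R : realType) (H : hilbertType R) (A : operator H) (m : R).
Hypotheses (m_gt0 : 0 < m) (gap : forall p, spectrum A p -> m <= p.1).
Hypothesis heat_tc : forall t : R, 0 < t -> trace_class A (heat t).
Implicit Types (t x L a : R) (z : R[i]).
Local Notation Re := (@complex.Re R).
Local Notation Im := (@complex.Im R).
Local Notation mu := (@lebesgue_measure R).
Local Notation pos := (`]0, +oo[%classic : set R).
Local Notation mpos := (@lebesgue_measurable_pos R).
Local Notation theta := (fun t => trace A (heat t)).

Definition truncated_zeta L z : R[i] :=
  truncated_trace A L (fun l => Re (cpow l (- z))) +i*
  truncated_trace A L (fun l => Im (cpow l (- z))).

Lemma truncated_zeta_sum L z :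
  truncated_zeta L z = \sum_(p <- fset_set (low_spectrum A L)) cpow p.1 (- z).
Proof.
have fE := finite_low_spectrum m_gt0 gap heat_tc L.
apply: complex_ext; rewrite /= /truncated_trace fsbig_finite//.
  by rewrite (big_morph Re (@cReD R) (cRe0 R)).
by rewrite (big_morph Im (@cImD R) (cIm0 R)).
Qed.

Lemma truncated_zeta_Gamma L z : 0 < Re z ->
  truncated_zeta L z * cGamma z = mellin (fun t => truncated_trace A L (heat t)) z.
Proof.
move=> z0; have fE := finite_low_spectrum m_gt0 gap heat_tc L.
have ppos p : p \in fset_set (low_spectrum A L) -> 0 < p.1.
  by rewrite in_fset_set// inE => -[_ /andP[]].
rewrite truncated_zeta_sum mulr_suml.
have -> : mellin (fun t => truncated_trace A L (heat t)) z =
    cintegral (fun t => \sum_(p <- fset_set (low_spectrum A L) | 0 < p.1)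
      (heat t p.1)%:C * cpow t (z - 1)).
  apply: eq_cintegral => t t0; rewrite -mulr_suml; congr (_ * _).
  rewrite /truncated_trace fsbig_finite// rmorph_sum/= big_seq [RHS]big_seq_cond.
  by apply: eq_bigl => p; case: (boolP (p \in _)) => // /ppos ->.
rewrite cintegral_sum => [|p p0]; last exact: mellin_cintegrable (heat_strip p0) z0.
rewrite big_seq [RHS]big_seq_cond.
rewrite [LHS](eq_bigl (fun p => (p \in fset_set (low_spectrum A L)) && (0 < p.1))).
  by apply: eq_bigr => p /andP[_ p0]; rewrite -mellin_heat.
by move=> p; case: (boolP (p \in _)) => // /ppos ->.
Qed.

Lemma norm_truncated_heat_le L t : 0 < t ->
  `|truncated_trace A L (heat t)| <= `|theta t|.
Proof.
move=> t0; rewrite !ger0_norm; first exact: (truncated_heat_le m_gt0 gap heat_tc).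
  exact: (heat_trace_ge0 m_gt0 gap heat_tc).
by apply: (truncated_trace_ge0 gap) => l _; exact: heat_ge0.
Qed.

Lemma normc_truncated_integrand_le L t z (M : R -> R) : 0 < t ->
  `|theta t| * t `^ (Re z - 1) <= M t ->
  normc ((truncated_trace A L (heat t))%:C * cpow t (z - 1)) <= M t.
Proof.
move=> t0; rewrite normcM normc_real normc_cpow// !ReImE; apply: le_trans.
by rewrite ler_wpM2r ?powR_ge0// norm_truncated_heat_le.
Qed.

Lemma cmeasurable_truncated_integrand L z :
  cmeasurable (fun t => (truncated_trace A L (heat t))%:C * cpow t (z - 1)).
Proof.
apply: cmeasurableM; last exact: cmeasurable_cpow.
apply: cmeasurable_real; exact: (measurable_truncated_heat m_gt0 gap heat_tc).
Qed.

Lemma normc_mellin_truncated_le a x : mellin_strip a theta -> a < x ->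
  exists K, forall L, normc (mellin (fun t => truncated_trace A L (heat t)) x%:C) <= K.
Proof.
move=> st ax; have [M iM h] := mellin_strip_majorant st ax.
exists (2 * \int[mu]_(t in pos) M t) => L.
have le t : 0 < t ->
    normc ((truncated_trace A L (heat t))%:C * cpow t (x%:C - 1)) <= M t.
  by move=> t0; apply: normc_truncated_integrand_le; last exact: h.
by apply: norm_cintegral_le => //; apply: cintegrable_le iM le;
  exact: cmeasurable_truncated_integrand.
Qed.

(** The partial sums of [l ^ (- x)], multiplied by [Gamma x], are Mellin
transforms of truncated heat traces, and these are bounded because the full
heat trace dominates them.  Then divide by [Gamma x]. *)
Lemma trace_class_powR a x : mellin_strip a theta -> a < x -> 1 <= x ->
  trace_class A (fun l => l `^ (- x)).
Proof.
move=> st ax x1; have [K hK] := normc_mellin_truncated_le st ax.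
have x0 : 0 < x by exact: lt_le_trans x1.
have G0 : 0 < normc (cGamma x%:C).
  rewrite lt_neqAle normc_ge0 eq_sym andbT.
  by apply: contraNN (cGamma_neq0 x1) => /eqP/eq0_normc ->.
apply: (trace_class_bounded m_gt0 gap heat_tc (C := K / normc (cGamma x%:C))) => L.
rewrite ler_pdivlMr//; apply: le_trans (hK L).
rewrite -truncated_zeta_Gamma// normcM; apply: ler_wpM2r; first exact: ltW.
apply: le_trans (norm_Re_le _); rewrite /=.
apply: le_trans (ler_norm _).
apply: (le_truncated_trace m_gt0 gap heat_tc) => l ml.
by rewrite oppr0 mul0r cos0 mulr1 ger0_norm ?powR_ge0.
Qed.

Lemma zeta_ctrace_class a z : mellin_strip a theta -> a < Re z -> 1 <= Re z ->
  ctrace_class A (fun l => cpow l (- z)).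
Proof.
move=> st az z1; have tc := trace_class_powR st az z1.
split; apply: (trace_class_le m_gt0 gap heat_tc (h := fun l => l `^ (- Re z)) (C := 1)) tc => l ml;
  have l0 : 0 < l by exact: lt_le_trans ml.
  rewrite mul1r (le_trans (norm_Re_le _))// normc_cpow// cReN; exact: ler_norm.
rewrite mul1r (le_trans (norm_Im_le _))// normc_cpow// cReN; exact: ler_norm.
Qed.

(** Let [L] tend to infinity in [truncated_zeta_Gamma].  Dominated convergence
replaces an exchange of sum and integral for a complex integrand. *)
Lemma zeta_Gamma_mellin a z : mellin_strip a theta -> a < Re z -> 1 <= Re z ->
  zeta A z * cGamma z = mellin theta z.
Proof.
move=> st az z1; have z0 : 0 < Re z by exact: lt_le_trans z1.
have [tr ti] := zeta_ctrace_class st az z1.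
have cr := truncated_trace_cvg m_gt0 gap heat_tc tr.
have ci := truncated_trace_cvg m_gt0 gap heat_tc ti.
have {}cr : Re (truncated_zeta n%:R z) @[n --> \oo] --> Re (zeta A z).
  exact: (cvg_comp (fun n => n%:R) _ cvgr_idn cr).
have {}ci : Im (truncated_zeta n%:R z) @[n --> \oo] --> Im (zeta A z).
  exact: (cvg_comp (fun n => n%:R) _ cvgr_idn ci).
have [M iM h] := mellin_strip_majorant st az.
have cT t : 0 < t -> truncated_trace A n%:R (heat t) @[n --> \oo] --> theta t.
  exact: (truncated_heat_cvg m_gt0 gap heat_tc).
have [dr di] : Re (mellin (fun t => truncated_trace A n%:R (heat t)) z) @[n --> \oo] --> Re (mellin theta z)
    /\ Im (mellin (fun t => truncated_trace A n%:R (heat t)) z) @[n --> \oo] --> Im (mellin theta z).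
  apply: (@cintegral_dominated_cvg _ (fun n t => (truncated_trace A n%:R (heat t))%:C * cpow t (z - 1))
    _ M) => //.
  - by move=> n; exact: cmeasurable_truncated_integrand.
  - apply: cmeasurableM; last exact: cmeasurable_cpow.
    apply: cmeasurable_real; exact: (measurable_heat_trace m_gt0 gap heat_tc).
  - by move=> n t t0; apply: normc_truncated_integrand_le; last exact: h.
  - move=> t t0; have -> : (fun n : nat => Re ((truncated_trace A n%:R (heat t))%:C * cpow t (z - 1))) =
      fun n => truncated_trace A n%:R (heat t) * Re (cpow t (z - 1)).
      by apply/funext => n; rewrite cReM/= mul0r subr0.
    by rewrite cReM/= mul0r subr0; apply: cvgMr_tmp; exact: cT.
  - move=> t t0; have -> : (fun n : nat => Im ((truncated_trace A n%:R (heat t))%:C * cpow t (z - 1))) =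
      fun n => truncated_trace A n%:R (heat t) * Im (cpow t (z - 1)).
      by apply/funext => n; rewrite cImM/= mul0r addr0.
    by rewrite cImM/= mul0r addr0; apply: cvgMr_tmp; exact: cT.
have e n : mellin (fun t => truncated_trace A n%:R (heat t)) z = truncated_zeta n%:R z * cGamma z.
  by rewrite truncated_zeta_Gamma.
apply: complex_ext.
  apply: esym; apply: (cvg_unique (@Rhausdorff R) dr); rewrite cReM.
  have -> : (fun n : nat => Re (mellin (fun t => truncated_trace A n%:R (heat t)) z)) =
    fun n => Re (truncated_zeta n%:R z) * Re (cGamma z) - Im (truncated_zeta n%:R z) * Im (cGamma z).
    by apply/funext => n; rewrite e cReM.
  by apply: cvgB; apply: cvgMr_tmp.
apply: esym; apply: (cvg_unique (@Rhausdorff R) di); rewrite cImM.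
have -> : (fun n : nat => Im (mellin (fun t => truncated_trace A n%:R (heat t)) z)) =
  fun n => Re (truncated_zeta n%:R z) * Im (cGamma z) + Im (truncated_zeta n%:R z) * Re (cGamma z).
  by apply/funext => n; rewrite e cImM.
by apply: cvgD; apply: cvgMr_tmp.
Qed.

End ZetaMellin.

(** * Continuation of Gamma times zeta and its residue *)

Section Residue.
Variables (R : realType) (H : hilbertType R) (A : operator H) (m : R).
Hypotheses (m_gt0 : 0 < m) (gap : forall p, spectrum A p -> m <= p.1).
Hypothesis heat_tc : forall t : R, 0 < t -> trace_class A (heat t).
Variables (k : nat) (s c : 'I_k.+1 -> R) (s' C d : R).
Hypothesis s_decr : forall i j : 'I_k.+1, (i < j)%N -> s j < s i.
Hypotheses (s'_lt : s' < s ord_max) (C_ge0 : 0 <= C) (d_gt0 : 0 < d) (d_le1 : d <= 1).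
Hypothesis expansion : forall t, 0 < t -> t < d ->
  `|trace A (heat t) - \sum_i c i * t `^ (- s i)| <= C * t `^ (- s').
Implicit Types (t x a : R) (z p : R[i]).
Local Notation Re := (@complex.Re R).
Local Notation Im := (@complex.Im R).
Local Notation pos := (`]0, +oo[%classic : set R).
Local Notation theta := (fun t => trace A (heat t)).

Lemma exponent_le_head i : s i <= s ord0.
Proof.
have [->//|i0] := eqVneq i ord0.
by apply/ltW/s_decr; rewrite lt0n.
Qed.

Lemma exponent_inj : injective s.
Proof.
move=> i j sij; apply: val_inj => /=.
by case: (ltngtP i j) => // /s_decr; rewrite sij ltxx.
Qed.

(** Near [0] every exponent of the expansion is dominated by the largest one,
[s ord0]. *)
Lemma heat_trace_bound t : 0 < t -> t < d ->
  theta t <= (\sum_i `|c i| + C) * t `^ (- s ord0).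
Proof.
move=> t0 td; have t1 : t <= 1 by apply: le_trans d_le1; exact: ltW.
have mono x : x <= s ord0 -> t `^ (- x) <= t `^ (- s ord0).
  by move=> xs; apply: ger_powR; rewrite ?t0// lerN2.
have h := expansion t0 td; rewrite ler_norml in h; case/andP: h => _ h.
rewrite lerBlDr addrC in h; apply: (le_trans h); rewrite mulrDl; apply: lerD.
  rewrite mulr_suml; apply: ler_sum => i _.
  apply: (@le_trans _ _ (`|c i| * t `^ (- s i))).
    by rewrite ler_wpM2r ?powR_ge0// ler_norm.
  by rewrite ler_wpM2l// mono// exponent_le_head.
rewrite ler_wpM2l// mono//; apply: le_trans (ltW s'_lt) _; exact: exponent_le_head.
Qed.

Lemma heat_trace_strip_head : mellin_strip (s ord0) theta.
Proof.
apply: (heat_trace_strip m_gt0 gap heat_tc d_gt0 (C := \sum_i `|c i| + C)).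
  by rewrite addr_ge0// sumr_ge0.
exact: heat_trace_bound.
Qed.

(** Cutting the expansion off at [1] keeps its terms from spoiling the decay at
infinity. *)
Definition heat_remainder t := theta t - ((t <= 1)%R%:R : R) * \sum_i c i * t `^ (- s i).

(** The [O] bound covers [t < d]; on [[d, 1]] everything is bounded; beyond [1]
only the heat trace is left. *)
Lemma heat_remainder_strip : mellin_strip s' heat_remainder.
Proof.
have th0 t : 0 < t -> 0 <= theta t by exact: (heat_trace_ge0 m_gt0 gap heat_tc).
split.
- apply: measurable_funB; first exact: (measurable_heat_trace m_gt0 gap heat_tc).
  apply: measurable_funM; first exact: measurable_le1.
  apply: measurable_sum => i; apply: measurable_funM => //.
  by apply: measurable_funTS; exact: measurable_powR.
- apply: (@powR_bound_ext _ _ _ C (theta d + \sum_i `|c i| * (1 + d `^ (- s i))) d) => //.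
  + rewrite addr_ge0 ?th0// sumr_ge0// => i _.
    by rewrite mulr_ge0// addr_ge0// powR_ge0.
  + move=> t t0 td; rewrite /heat_remainder.
    have -> : t <= 1 by apply: le_trans d_le1; exact: ltW.
    by rewrite mul1r; exact: expansion.
  + move=> t dt t1; have t0 : 0 < t by exact: lt_le_trans dt.
    rewrite /heat_remainder t1 mul1r; apply: (le_trans (ler_normB _ _)); apply: lerD.
      by rewrite ger0_norm ?th0//; exact: (heat_trace_nonincreasing m_gt0 gap heat_tc).
    apply: (le_trans (ler_norm_sum _ _ _)); apply: ler_sum => i _.
    rewrite normrM ler_wpM2l// ger0_norm ?powR_ge0//.
    exact: powR_le_segment.
- move=> b; have [C' hC'] := heat_trace_fast_decay m_gt0 gap heat_tc b.
  (* The cut-off is still active at [t = 1], whence the extra term. *)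
  exists (C' + `|heat_remainder 1|) => t t1.
  have C'0 : 0 <= C'.
    by have := hC' 1 (lexx _); rewrite powR1 mulr1; exact: le_trans.
  have [->|tn1] := eqVneq t 1; first by rewrite powR1 mulr1 lerDr.
  have t1' : 1 < t by rewrite lt_neqAle eq_sym tn1.
  have t1F : (t <= 1) = false by rewrite leNgt t1'.
  rewrite /heat_remainder t1F mul0r subr0; apply: (le_trans (hC' t t1)).
  by rewrite ler_wpM2r ?powR_ge0// lerDl.
Qed.

Definition zeta_Gamma_continuation z : R[i] :=
  \sum_i (c i)%:C / (z - (s i)%:C) + mellin heat_remainder z.

Lemma mellin_heat_trace z : s ord0 < Re z ->
  mellin theta z = zeta_Gamma_continuation z.
Proof.
move=> sz; have s'z : s' < Re z.
  apply: le_lt_trans sz; apply: le_trans (ltW s'_lt) _; exact: exponent_le_head.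
have w0 i : 0 < Re (z - (s i)%:C).
  by rewrite cReD cReN /= subr_gt0 (le_lt_trans (exponent_le_head i)).
pose w i := z - (s i)%:C.
have ip i : cintegrable (fun t => ((t <= 1)%R%:R)%:C * cpow t (w i - 1)).
  exact: (cintegrable_cpow_le1 (w0 i)).
have ir := mellin_cintegrable heat_remainder_strip s'z.
have -> : mellin theta z = cintegral (fun t =>
   \sum_i (c i)%:C * (((t <= 1)%R%:R)%:C * cpow t (w i - 1)) +
   (heat_remainder t)%:C * cpow t (z - 1)).
  apply: eq_cintegral => t t0.
  have -> : \sum_i (c i)%:C * (((t <= 1)%R%:R)%:C * cpow t (w i - 1)) =
     (((t <= 1)%R%:R : R) * \sum_i c i * t `^ (- s i))%:C * cpow t (z - 1).
    rewrite rmorphM rmorph_sum/= mulr_sumr mulr_suml; apply: eq_bigr => i _.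
    rewrite rmorphM/= -(cpow_real (- s i) t0).
    have -> : w i - 1 = (- s i)%:C + (z - 1) by rewrite /w rmorphN/=; ring.
    rewrite cpowD//; ring.
  by rewrite -mulrDl -rmorphD/=; congr (_%:C * _); rewrite /heat_remainder; ring.
rewrite cintegralD//; last first.
  by apply: cintegrable_sum => i _; exact: cintegrableZ.
rewrite cintegral_sum; last by move=> i _; exact: cintegrableZ.
rewrite /zeta_Gamma_continuation; congr (_ + _); apply: eq_bigr => i _.
by rewrite (cintegralZ _ (ip i)) (cintegral_cpow_le1 (w0 i)).
Qed.

(** Sorting the poles by whether they lie at [p] treats poles and regular points
alike: at a regular point the sum over [i] is empty. *)
Lemma zeta_Gamma_principal_part p : s' < Re p ->
  principal_part zeta_Gamma_continuation p 1
    (fun=> \sum_(i | (s i)%:C == p) (c i)%:C).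
Proof.
move=> s'p; exists (fun z => \sum_(i | (s i)%:C != p) (c i)%:C / (z - (s i)%:C) +
  mellin heat_remainder z); split.
  apply: holomorphicD; last exact: mellin_holomorphic heat_remainder_strip s'p.
  by apply: holomorphic_sum => i si; apply: holomorphic_div; rewrite eq_sym.
rewrite /zeta_Gamma_continuation; near=> z.
rewrite big_ord1 expr1 (bigID (fun i => (s i)%:C == p))/= -addrA; congr (_ + _).
by rewrite mulr_suml; apply: eq_bigr => i /eqP ->.
Unshelve. all: end_near. Qed.

Lemma zeta_Gamma_residue_last : zeta_Gamma_residue A (s ord_max)%:C (c ord_max)%:C.
Proof.
exists zeta_Gamma_continuation, s', (Order.max (s ord0) 1); split => //.
- by rewrite lt_max ltr01 orbT.
- by move=> z s'z; exists 1, (fun=> \sum_(i | (s i)%:C == z) (c i)%:C); exact: zeta_Gamma_principal_part.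
- move=> z; rewrite gt_max => /andP[sz z1]; split.
    exact: (zeta_ctrace_class m_gt0 gap heat_tc heat_trace_strip_head sz (ltW z1)).
  rewrite -mellin_heat_trace//.
  by rewrite (zeta_Gamma_mellin m_gt0 gap heat_tc heat_trace_strip_head sz (ltW z1)).
exists 0, (fun=> \sum_(i | (s i)%:C == (s ord_max)%:C) (c i)%:C); split.
  exact: zeta_Gamma_principal_part.
rewrite (big_pred1 ord_max)// => i.
by apply/eqP/eqP => [[]/exponent_inj|->].
Qed.

End Residue.

(** * The cutoff function *)

Section Cutoff.
Variable R : realType.

(** A combination of heat operators, since [exp_comb b (t * l)] is a combination
of the [heat (expR j * t) l].  The scales [expR j] are chosen so that
[(expR j) ^ (- s) = (expR (- s)) ^ j] is a power of one node. *)
Definition exp_comb (n : nat) (b : 'I_n -> R) (x : R) : R :=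
  \sum_(j < n) b j * expR (- (expR j%:R * x)).

Lemma measurable_exp_comb n (b : 'I_n -> R) (D : set R) :
  measurable_fun D (exp_comb b).
Proof.
apply: measurable_funTS; apply: measurable_sum => j.
apply: measurable_funM => //; apply: measurableT_comp => //.
by apply: measurableT_comp => //; apply: measurable_funM.
Qed.

(** The coefficients of the Lagrange basis polynomial at [y i0]. *)
Lemma lagrange_coefficients (n : nat) (y : 'I_n -> R) (i0 : 'I_n) : injective y ->
  exists b : 'I_n -> R, forall i, \sum_(j < n) b j * y i ^+ j = (i == i0)%:R.
Proof.
move=> yinj; pose q := \prod_(i | i != i0) ('X - (y i)%:P).
have qi i : i != i0 -> q.[y i] = 0.
  by move=> ii; rewrite /q (bigD1 i)//= hornerM hornerXsubC subrr mul0r.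
have q0 : q.[y i0] != 0.
  rewrite /q horner_prod prodf_seq_neq0; apply/allP => i _; apply/implyP => ii.
  by rewrite hornerXsubC subr_eq0; apply: contra ii => /eqP/yinj ->.
have sq : (size q <= n)%N.
  rewrite /q -big_filter size_prod_XsubC -sum1_size big_filter sum1_card.
  by rewrite cardC1 card_ord prednK// (leq_ltn_trans _ (ltn_ord i0)).
exists (fun j => q.[y i0]^-1 * q`_j) => i.
under eq_bigr do rewrite -mulrA.
rewrite -mulr_sumr -(horner_coef_wide _ sq).
by case: eqVneq => [->|/qi ->]; rewrite ?mulr0// mulVf.
Qed.

End Cutoff.

(** * Powers at infinity *)

Section PowerLimits.
Variable R : realType.
Implicit Types (t x a L : R).

Lemma powRN_cvg0 a : 0 < a -> L `^ (- a) @[L --> +oo] --> (0 : R).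
Proof.
move=> a0; apply/cvgrPdist_le => e e0.
near=> L; rewrite sub0r normrN ger0_norm ?powR_ge0//.
have Le : e `^ (- a^-1) <= L by near: L; apply: nbhs_pinfty_ge; exact: num_real.
have e1 : 0 < e `^ (- a^-1) by exact: powR_gt0.
have -> : e = (e `^ (- a^-1)) `^ (- a).
  by rewrite -powRrM mulrNN mulVf ?gt_eqF// powRr1// ltW.
have L0 : 0 < L by exact: lt_le_trans Le.
rewrite [leLHS]powRN [leRHS]powRN lef_pV2 ?posrE ?powR_gt0//.
by apply: ge0_ler_powR => //; rewrite ?nnegrE; exact: ltW.
Unshelve. all: end_near. Qed.

Lemma ln_le_sqrt L : 0 < L -> ln L <= 2 * L `^ (2^-1).
Proof.
move=> L0; have h : ln (L `^ 2^-1) <= L `^ 2^-1.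
  rewrite -ler_expR lnK ?posrE ?powR_gt0//.
  by apply: le_trans (expR_ge1Dx _); rewrite lerDr.
rewrite ln_powR in h; lra.
Qed.

End PowerLimits.

(** * The limit of the truncated traces *)

Section Limit.
Variables (R : realType) (H : hilbertType R) (A : operator H) (m : R).
Hypotheses (m_gt0 : 0 < m) (gap : forall p, spectrum A p -> m <= p.1).
Hypothesis heat_tc : forall t : R, 0 < t -> trace_class A (heat t).
Variables (k : nat) (s c : 'I_k.+1 -> R) (s' C d : R).
Hypothesis s_decr : forall i j : 'I_k.+1, (i < j)%N -> s j < s i.
Hypotheses (s'_lt : s' < s ord_max) (C_ge0 : 0 <= C) (d_gt0 : 0 < d) (d_le1 : d <= 1).
Hypothesis expansion : forall t, 0 < t -> t < d ->
  `|trace A (heat t) - \sum_i c i * t `^ (- s i)| <= C * t `^ (- s').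
Variable b : 'I_k.+1 -> R.
Hypothesis b_interp : forall i, \sum_(j < k.+1) b j * expR (- s i) ^+ j = (i == ord_max)%:R.
Implicit Types (t x a l L : R).
Local Notation theta := (fun t => trace A (heat t)).
Let B := \sum_j `|b j|.

Lemma exp_comb_heat t : (fun l => exp_comb b (t * l)) =
  fun l => \sum_(j < k.+1) b j * heat (expR j%:R * t) l.
Proof. by apply/funext => l; apply: eq_bigr => j _; rewrite /heat mulrA. Qed.

Lemma trace_exp_comb t : 0 < t ->
  trace_class A (fun l => exp_comb b (t * l)) /\
  trace A (fun l => exp_comb b (t * l)) = \sum_(j < k.+1) b j * theta (expR j%:R * t).
Proof.
move=> t0; rewrite exp_comb_heat.
have jt (j : 'I_k.+1) : 0 < expR j%:R * t by rewrite mulr_gt0 ?expR_gt0.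
have tc (j : 'I_k.+1) : trace_class A (fun l => b j * heat (expR j%:R * t) l).
  apply: (trace_class_le m_gt0 gap heat_tc (h := heat (expR j%:R * t)) (C := `|b j|)).
    by move=> l _; rewrite normrM.
  exact: heat_tc.
have [h1 h2] := trace_sum m_gt0 gap heat_tc (index_enum _) tc.
split => //; rewrite h2; apply: eq_bigr => j _.
by rewrite (traceZ m_gt0 gap heat_tc)//; exact: heat_tc.
Qed.

(** The interpolation conditions kill every term but the last. *)
Lemma interpolated_expansion t : 0 < t ->
  \sum_(j < k.+1) b j * \sum_i c i * (expR j%:R * t) `^ (- s i) =
  c ord_max * t `^ (- s ord_max).
Proof.
move=> t0; under eq_bigr do rewrite mulr_sumr.
rewrite exchange_big/= (bigD1 ord_max)//= [X in _ + X]big1 ?addr0.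
  under eq_bigr => j _.
    rewrite powRM ?expR_ge0 ?(ltW t0)// -expRM.
    rewrite (_ : b j * _ = (c ord_max * t `^ (- s ord_max)) * (b j * expR (- s ord_max) ^+ j)); last first.
      by rewrite -expRM_natr [j%:R * _]mulrC; ring.
    over.
  by rewrite -mulr_sumr b_interp eqxx mulr1.
move=> i /negPf im.
under eq_bigr => j _.
  rewrite powRM ?expR_ge0 ?(ltW t0)// -expRM.
  rewrite (_ : b j * _ = (c i * t `^ (- s i)) * (b j * expR (- s i) ^+ j)); last first.
    by rewrite -expRM_natr [j%:R * _]mulrC; ring.
  over.
by rewrite -mulr_sumr b_interp im mulr0.
Qed.

Lemma full_trace_estimate : exists2 K, 0 <= K & forall t, 0 < t -> t < d * expR (- k%:R) ->
  `|t `^ s ord_max * trace A (fun l => exp_comb b (t * l)) - c ord_max|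
    <= K * t `^ (s ord_max - s').
Proof.
(* [t < d * expR (- k)] keeps all the arguments [expR j * t], [j <= k], below
   [d], where the expansion is controlled. *)
exists (\sum_(j < k.+1) `|b j| * (C * expR j%:R `^ (- s'))).
  by apply: sumr_ge0 => j _; rewrite !mulr_ge0 ?powR_ge0.
move=> t t0 td; have [_ ->] := trace_exp_comb t0.
have tn : t != 0 by rewrite gt_eqF.
have tp r u : t `^ (r + u) = t `^ r * t `^ u by rewrite powRD// tn implybT.
have -> : c ord_max = t `^ s ord_max * (c ord_max * t `^ (- s ord_max)).
  by rewrite mulrCA -tp subrr powRr0 mulr1.
rewrite -interpolated_expansion// -mulrBr -sumrB tp normrM.
rewrite (ger0_norm (powR_ge0 _ _)) mulrCA ler_wpM2l ?powR_ge0//.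
rewrite mulr_suml; apply: (le_trans (ler_norm_sum _ _ _)); apply: ler_sum => j _.
rewrite -mulrBr normrM -mulrA ler_wpM2l//.
have jt : 0 < expR j%:R * t by rewrite mulr_gt0 ?expR_gt0.
rewrite -mulrA -powRM ?expR_ge0 ?(ltW t0)//; apply: expansion => //.
apply: (@le_lt_trans _ _ (expR k%:R * t)).
  by rewrite ler_wpM2r ?(ltW t0)// ler_expR ler_nat -ltnS.
by rewrite mulrC -ltr_pdivlMr ?expR_gt0// -expRN.
Qed.

Lemma norm_exp_comb_le x : 0 <= x -> `|exp_comb b x| <= B * expR (- x).
Proof.
move=> x0; apply: (le_trans (ler_norm_sum _ _ _)); rewrite mulr_suml.
apply: ler_sum => j _; rewrite normrM ler_wpM2l// ger0_norm ?expR_ge0//.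
rewrite ler_expR lerN2 ler_peMl// -[leLHS]expR0 ler_expR//.
Qed.

(** Above the level [L], split the exponent [- t l] into a fraction [1 - e], which makes
the term small because [l > L], and a fraction [e], which keeps the sum over
the spectrum convergent. *)
Lemma tail_estimate L t e : 0 <= L -> 0 < t -> 0 < e -> e < 1 ->
  `|trace A (fun l => exp_comb b (t * l)) - truncated_trace A L (fun l => exp_comb b (t * l))|
    <= B * expR (- ((1 - e) * (t * L))) * theta (e * t).
Proof.
move=> L0 t0 e0 e1; have [tc _] := trace_exp_comb t0.
have et : 0 < e * t by rewrite mulr_gt0.
have B0 : 0 <= B by exact: sumr_ge0.
set q := B * _; have q0 : 0 <= q by rewrite mulr_ge0 ?expR_ge0.
rewrite -(traceZ m_gt0 gap heat_tc _ (heat_tc et)).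
apply: (trace_tail_le m_gt0 gap heat_tc) => //.
- apply: (trace_class_le m_gt0 gap heat_tc (h := heat (e * t)) (C := `|q|)).
    by move=> l _; rewrite normrM.
  exact: heat_tc.
- by move=> l _; rewrite mulr_ge0 ?expR_ge0.
move=> l Ll; have l0 : 0 <= l by apply: le_trans L0 _; exact: ltW.
apply: (le_trans (norm_exp_comb_le _)); first by rewrite mulr_ge0// ltW.
rewrite /q -mulrA ler_wpM2l// /heat -expRD ler_expR.
have : (1 - e) * t * L <= (1 - e) * t * l.
  by rewrite ler_wpM2l// ?(ltW Ll)// mulr_ge0 ?(ltW t0)// subr_ge0 ltW.
by rewrite !mulrBl !mul1r; nra.
Qed.

Lemma cutoff_trace_cvg M : s ord0 - s ord_max < M ->
  (M * ln L / L) `^ s ord_max *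
    truncated_trace A L (fun l => exp_comb b ((M * ln L / L) * l))
  @[L --> +oo] --> c ord_max.
Proof.
move=> DM; set D := s ord0 - s ord_max in DM.
have D0 : 0 <= D by rewrite subr_ge0; exact: exponent_le_head.
have M0 : 0 < M by exact: le_lt_trans DM.
have [K K0 hK] := full_trace_estimate.
(* With this choice [(1 - e) * M] is the midpoint of [D] and [M], so the tail,
   of order [L ^ (D - (1 - e) * M)], decays like [L ^ (- q1)]. *)
pose e := (M - D) / (2 * M).
have e0 : 0 < e by rewrite divr_gt0 ?mulr_gt0 ?subr_gt0.
have e1 : e < 1 by rewrite ltr_pdivrMr ?mulr_gt0//; lra.
have eM : (1 - e) * M = (M + D) / 2 by rewrite /e; field; rewrite gt_eqF.
pose q1 := (M - D) / 2; have q10 : 0 < q1 by rewrite divr_gt0// subr_gt0.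
(* [M * ln L / L] is at most [2 * M * L ^ (- 1 / 2)], so the error of
   [full_trace_estimate] is of order [L ^ (- q2)]. *)
pose q2 := 2^-1 * (s ord_max - s'); have q20 : 0 < q2 by rewrite mulr_gt0 ?invr_gt0// subr_gt0.
have B0 : 0 <= B by exact: sumr_ge0.
pose K1 := B * ((\sum_i `|c i| + C) * e `^ (- s ord0)).
pose K2 := K * (2 * M) `^ (s ord_max - s').
have K10 : 0 <= K1.
  by rewrite mulr_ge0// mulr_ge0 ?powR_ge0// addr_ge0// sumr_ge0.
have bound : \forall L \near +oo,
    `|(M * ln L / L) `^ s ord_max *
      truncated_trace A L (fun l => exp_comb b ((M * ln L / L) * l)) - c ord_max|
    <= K1 * L `^ (- q1) + K2 * L `^ (- q2).
  have h0 : L `^ (- 2^-1) @[L --> +oo] --> (0 : R) by apply: powRN_cvg0; rewrite invr_gt0.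
  pose d' := d * expR (- k%:R) / (2 * M).
  have d'0 : 0 < d' by rewrite divr_gt0 ?mulr_gt0 ?expR_gt0.
  near=> L.
  have L1 : 1 < L by near: L; apply: nbhs_pinfty_gt; exact: num_real.
  have L0 : 0 < L by exact: lt_trans L1.
  have LM : expR M^-1 <= L by near: L; apply: nbhs_pinfty_ge; exact: num_real.
  have Ld : L `^ (- 2^-1) < d'.
    have : `|0 - L `^ (- 2^-1)| < d' by near: L; exact: (cvgrPdist_lt _ _).1 h0 _ d'0.
    by rewrite sub0r normrN ger0_norm// powR_ge0.
  have lnM : 1 <= M * ln L.
    have : M^-1 <= ln L by rewrite -ler_expR lnK// posrE.
    by rewrite -(ler_pM2l M0) mulfV ?gt_eqF.
  set t := M * ln L / L.
  have Lt : L^-1 <= t by rewrite /t ler_peMl// invr_ge0 ltW.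
  have t0 : 0 < t by apply: lt_le_trans Lt; rewrite invr_gt0.
  have tL : t * L = M * ln L by rewrite /t divfK// gt_eqF.
  have Ln r u : L `^ r * L `^ u = L `^ (r + u).
    by rewrite powRD// (gt_eqF L0) implybT.
  have tle : t <= (2 * M) * L `^ (- 2^-1).
    have -> : L `^ (- 2^-1) = L `^ 2^-1 / L.
      by rewrite -(powR_inv1 (ltW L0)) Ln; congr (_ `^ _); field.
    rewrite /t mulrA ler_wpM2r ?invr_ge0 ?(ltW L0)//.
    by rewrite [2 * M]mulrC -mulrA ler_wpM2l ?(ltW M0)// ln_le_sqrt.
  have td : t < d * expR (- k%:R).
    apply: (le_lt_trans tle); rewrite mulrC -ltr_pdivlMr//.
    by rewrite mulr_gt0.
  have tdd : e * t < d.
    apply: (@lt_le_trans _ _ (d * expR (- k%:R))).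
      apply: lt_trans td; rewrite gtr_pMl//.
    by rewrite ler_piMr ?(ltW d_gt0)// -[leRHS]expR0 ler_expR oppr_le0.
  have et0 : 0 < e * t by rewrite mulr_gt0.
  have tn r u : t `^ r * t `^ u = t `^ (r + u).
    by rewrite powRD// (gt_eqF t0) implybT.
  set T := trace A (fun l => exp_comb b (t * l)).
  set TL := truncated_trace A L _.
  have -> : t `^ s ord_max * TL - c ord_max =
    - (t `^ s ord_max * (T - TL)) + (t `^ s ord_max * T - c ord_max) by ring.
  apply: (le_trans (ler_normD _ _)); apply: lerD; last first.
    apply: (le_trans (hK t t0 td)); rewrite /K2 -mulrA ler_wpM2l//.
    have -> : L `^ (- q2) = (L `^ (- 2^-1)) `^ (s ord_max - s').
      by rewrite -powRrM mulNr.
    rewrite -powRM ?powR_ge0 ?mulr_ge0 ?(ltW M0)//.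
    apply: ge0_ler_powR => //; rewrite ?nnegrE ?subr_ge0; first exact: ltW.
      exact: ltW.
    by rewrite mulr_ge0 ?powR_ge0// mulr_ge0 ?(ltW M0).
  rewrite normrN normrM ger0_norm ?powR_ge0//.
  have h1 := tail_estimate (ltW L0) t0 e0 e1; rewrite -/T -/TL tL in h1.
  have h2 := heat_trace_bound s_decr s'_lt C_ge0 d_le1 expansion et0 tdd.
  have eL : expR (- ((1 - e) * (M * ln L))) = L `^ (- ((M + D) / 2)).
    by rewrite /powR (gt_eqF L0) mulrA eM mulNr.
  rewrite eL in h1.
  have tD : t `^ (- D) <= L `^ D.
    have h : (L^-1) `^ D <= t `^ D.
      by apply: ge0_ler_powR => //; rewrite nnegrE ?invr_ge0; exact: ltW.
    rewrite -(powR_inv1 (ltW L0)) -powRrM mulN1r powRN in h.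
    by rewrite powRN -[leRHS]invrK lef_pV2 ?posrE ?invr_gt0 ?powR_gt0.
  apply: (@le_trans _ _ (t `^ s ord_max * (B * L `^ (- ((M + D) / 2)) *
    ((\sum_i `|c i| + C) * (e * t) `^ (- s ord0))))).
    rewrite ler_wpM2l ?powR_ge0//; apply: (le_trans h1).
    by rewrite ler_wpM2l// mulr_ge0 ?powR_ge0.
  have -> : (e * t) `^ (- s ord0) = e `^ (- s ord0) * t `^ (- s ord0).
    by apply: powRM; exact: ltW.
  have -> : t `^ s ord_max * (B * L `^ (- ((M + D) / 2)) *
     ((\sum_i `|c i| + C) * (e `^ (- s ord0) * t `^ (- s ord0)))) =
    K1 * (L `^ (- ((M + D) / 2)) * (t `^ s ord_max * t `^ (- s ord0))) by rewrite /K1; ring.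
  rewrite tn ler_wpM2l//.
  have -> : s ord_max - s ord0 = - D by rewrite /D opprB.
  have -> : - q1 = - ((M + D) / 2) + D by rewrite /q1; field.
  by rewrite -Ln ler_wpM2l ?powR_ge0.
have to0 : K1 * L `^ (- q1) + K2 * L `^ (- q2) @[L --> +oo] --> (0 : R).
  have -> : 0 = K1 * 0 + K2 * 0 :> R by rewrite !mulr0 addr0.
  by apply: cvgD; apply: cvgMl_tmp; apply: powRN_cvg0.
apply/cvgrPdist_le => r r0; near=> L.
rewrite distrC.
have h1 : `|0 - (K1 * L `^ (- q1) + K2 * L `^ (- q2))| <= r.
  by near: L; exact: (cvgrPdist_le _ _).1 to0 _ r0.
apply: le_trans (near bound L _) _ => //.
by apply: le_trans h1; rewrite sub0r normrN ler_norm.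
Unshelve. all: end_near. Qed.

End Limit.

(** * Spectral cutoff formula for the residue *)

Lemma bigO_at_right (R : realType) (f g : R -> R) : f =O_ ((0 : R)^'+) g ->
  exists C d, [/\ 0 <= C, 0 < d, d <= 1 &
    forall t, 0 < t -> t < d -> `|f t| <= C * `|g t|].
Proof.
move=> /eqO_exP[C C0 [d /= d0 h]].
exists C, (Order.min d 1); split => //; first exact: ltW.
- by rewrite lt_min d0 ltr01.
- by rewrite ge_min lexx orbT.
move=> t t0; rewrite lt_min => /andP[td _]; apply: h => //=.
by rewrite sub0r normrN gtr0_norm.
Qed.

Unset Implicit Arguments.

Theorem theorem2p3 (R : realType) (k : nat) (s : 'I_k.+1 -> R)
    (s_decr : forall i j : 'I_k.+1, (i < j)%N -> s j < s i) :
  exists F : R -> R,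
    measurable_fun (`]0, +oo[ : set R) F /\
    forall (H : hilbertType R) (Delta : operator H), heat_class s Delta ->
    forall m : R, s ord0 - s ord_max < m ->
    let eps (L : R) := m * ln L / L in
    exists r : R,
      zeta_Gamma_residue Delta (s ord_max)%:C r%:C /\
      eps L `^ s ord_max * truncated_trace Delta L (fun l => F (eps L * l))
        @[L --> +oo] --> r.
Proof.
have yinj : injective (fun i => expR (- s i)).
  by move=> i j /expR_inj /oppr_inj /(exponent_inj s_decr).
have [b hb] := lagrange_coefficients ord_max yinj.
exists (exp_comb b); split; first exact: measurable_exp_comb.
move=> H Delta [[[_ posD invD _ _] [heat_tc _]] [c [s' [s's /bigO_at_right[C [d [C0 d0 d1 h]]]]]]] m Dm eps.
have [mu mu0 gap] := spectrum_gap posD invD.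
have expansion t : 0 < t -> t < d ->
    `|trace Delta (heat t) - \sum_i c i * t `^ (- s i)| <= C * t `^ (- s').
  by move=> t0 /(h t t0); rewrite (ger0_norm (powR_ge0 _ _)).
exists (c ord_max); split.
  exact: (zeta_Gamma_residue_last mu0 gap heat_tc s_decr s's C0 d0 d1 expansion).
exact: (cutoff_trace_cvg mu0 gap heat_tc s_decr s's C0 d0 d1 expansion hb Dm).
Qed.
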